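(* Suppose that Assumptions (A1)--(A4) listed in the context hold, let $r\in(0,1)$ be fixed and put $k^*:=\lfloor rn\rfloor$. Then, under the null hypothesis $H_0$ of no change point (i.e. $y_t=X_{t-1}'\beta_0+e_t$ for all $t$), the maximum empirical likelihood estimator $\hat\beta_{n,k^*}$ satisfies, as $n\to\infty$, $$\hat\beta_{n,k^*}-\beta_0=O_p(n^{-1/2}).$$
   Context: Setting. Let $p\ge 1$, $q\ge 0$, $m=p+q$. Let $\{e_t:t\in\mathbb Z\}$ be i.i.d. real random variables with distribution function $F$. Under $H_0$, $\{y_t:t\in\mathbb{Z}\}$ is the stationary causal AR($p$) process $y_t=X_{t-1}'\beta_0+e_t$, with $X_{t-1}=(y_{t-1},\dots,y_{t-p})'$ and true parameter $\beta_0\in\mathbb R^p$; in particular $X_{t-1}$ is independent of $e_t$, and the expectations below do not depend on $t$. The observations are $y_{1-p},\dots,y_n$. A prime denotes transpose, $\|\cdot\|$ is the Euclidean/Frobenius norm, and $0_m$ is the zero vector of $\mathbb R^m$. Moment function. Let $w:\mathbb R^p\to(0,\infty)$ and $\varphi:\mathbb R^p\to\mathbb R^q$ be measurable, $w_{t-1}=w(y_{t-1},\dots,y_{t-p})$, $a(x)=(x',\varphi(x)')'\in\mathbb R^m$ (so $a(x)=x$ if $q=0$), and $a^*(X_{t-1})=w_{t-1}a(X_{t-1})$. For $\beta\in\mathbb R^p$ put $$g_t(\beta)=\Big\{\tfrac12-\mathbb I(y_t-X_{t-1}'\beta\le 0)\Big\}a^*(X_{t-1}),\qquad t=1,\dots,n,$$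 where $\mathbb I$ is the indicator function. Empirical likelihood ratio. For $1\le k\le n-1$ and $\theta_1,\theta_2\in\mathbb R^p$ let $$l_{n,k}(\theta_1,\theta_2)=-\log\sup\Big\{\prod_{i=1}^k kv_i\prod_{j=k+1}^n(n-k)v_j\Big\},$$ the supremum being over all $(v_1,\dots,v_n)\in[0,1]^n$ with $\sum_{i=1}^kv_i=\sum_{j=k+1}^nv_j=1$ and $\sum_{i=1}^kv_ig_i(\theta_1)=\sum_{j=k+1}^nv_jg_j(\theta_2)=0_m$ (the supremum over the empty set is $0$, giving $l_{n,k}=+\infty$). Estimator. $\hat\beta_{n,k}\in\mathcal B$ is defined by $-l_{n,k}(\hat\beta_{n,k},\hat\beta_{n,k})=\sup_{\beta\in\mathcal B}\{-l_{n,k}(\beta,\beta)\}$. Assumptions. (A1) (i) $\beta_0\in\mathrm{Int}(\mathcal B)$, where the parameter space $\mathcal B\subset\mathbb R^p$ is compact with non-empty interior; (ii) $1-\beta_1z-\cdots-\beta_pz^p\ne0$ for all complex $|z|\le1$ and all $\beta=(\beta_1,\dots,\beta_p)'\in\mathcal B$; (iii) the median of $e_t$ is zero; (iv) $F$ is continuous and differentiable at the point $0$ with positive derivative $F'(0)=f(0)$, where $f$ is the probability density function of $e_t$. (A2) $\mathbb E[(w_{t-1}+w_{t-1}^2)(\|a(X_{t-1})\|^2+\|a(X_{t-1})\|^3)]<\infty$. (A3) The matrix $\mathbb E[g_t(\beta_0)g_t(\beta_0)']$ is positive definite. (A4) (i) There is a constant $\gamma>2$ with $\mathbb E[\|a^*(X_{t-1})\|^\gamma]<\infty$;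 (ii) with $v_t:=\mathrm{sign}(e_t)a^*(X_{t-1})$, the sequence $\{v_t:t\in\mathbb Z\}$ is strong mixing with mixing coefficients $\alpha_l$ satisfying $\sum_{l=1}^\infty\alpha_l^{1-2/\gamma}<\infty$. *)

(* Defs.v *)
(* Analysis and probability over an abstract [R : realType], in MathComp and
   MathComp-Analysis. *)
From mathcomp Require Import all_boot all_order all_algebra.
From mathcomp Require Import complex.
From mathcomp Require Import all_classical all_reals all_analysis.

Set Implicit Arguments.
Unset Strict Implicit.
Unset Printing Implicit Defensive.

Import Order.TTheory GRing.Theory Num.Theory.
Import numFieldTopology.Exports numFieldNormedType.Exports.

Local Open Scope classical_set_scope.
Local Open Scope ring_scope.

(* R^n as column vectors. The library norm on matrices is the sup norm, so the
   Euclidean norm is spelled out; the topologies agree. *)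
Definition norm2 (R : realType) (n : nat) (x : 'cV[R]_n) : R :=
  Num.sqrt (\sum_(i < n) x i 0 ^+ 2).

Definition dotp (R : realType) (n : nat) (x y : 'cV[R]_n) : R :=
  (x^T *m y) 0 0.

Definition posdef (R : realType) (n : nat) (M : 'M[R]_n) : Prop :=
  M^T = M /\ forall u : 'cV[R]_n, u != 0 -> 0 < (u^T *m M *m u) 0 0.

(* R^n with its Borel sigma-algebra; convertible to ['cV[R]_n]. *)
Definition borel_cV (R : realType) (n : nat) :=
  g_sigma_algebraType (@open 'cV[R]_n).

(* The product rule over every finite set of indices. *)
Definition mutually_independent (R : realType) (d : measure_display)
    (T : measurableType d) (P : probability T R) (e : int -> {RV P >-> R}) :
    Prop :=
  forall (s : seq int) (B : int -> set R), uniq s ->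
    (forall t, measurable (B t)) ->
    P (\big[setI/setT]_(t <- s) (e t @^-1` B t)) =
    (\prod_(t <- s) P (e t @^-1` B t))%E.

Definition identically_distributed (R : realType) (d : measure_display)
    (T : measurableType d) (P : probability T R) (e : int -> {RV P >-> R}) :
    Prop :=
  forall (s t : int) (B : set R), measurable B ->
    P (e s @^-1` B) = P (e t @^-1` B).

(* Shift-invariance of the finite-dimensional distributions, tested on
   measurable rectangles. *)
Definition strictly_stationary (R : realType) (d : measure_display)
    (T : measurableType d) (P : probability T R) (y : int -> {RV P >-> R}) :
    Prop :=
  forall (h : int) (s : seq int) (B : int -> set R),
    (forall t, measurable (B t)) ->
    P (\big[setI/setT]_(t <- s) (y (t + h) @^-1` B t)) =
    P (\big[setI/setT]_(t <- s) (y t @^-1` B t)).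

(* y is a causal function of e: y_t = \sum_(j >= 0) psi_j e_(t - j) almost
   surely, with absolutely summable psi. *)
Definition causal (R : realType) (d : measure_display)
    (T : measurableType d) (P : probability T R) (e y : int -> {RV P >-> R}) :
    Prop :=
  exists psi : nat -> R, cvgn (series (fun j => `|psi j|)) /\
    forall t : int, {ae P, forall om,
      series (fun j : nat => psi j * e (t - j%:Z) om) @ \oo --> y t om}.

(* [lags p y t om] is (y_t, ..., y_(t - p + 1))', that is X_t. *)
Definition lags (R : realType) (T : Type) (p : nat) (y : int -> T -> R)
    (t : int) (om : T) : 'cV[R]_p :=
  \col_(i < p) y (t - i%:Z) om.

Definition stationary_causal_AR (R : realType) (d : measure_display)
    (T : measurableType d) (P : probability T R) (p : nat) (beta : 'cV[R]_p)
    (e y : int -> {RV P >-> R}) : Prop :=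
  [/\ forall t : int, {ae P, forall om,
        y t om = dotp (lags p y (t - 1) om) beta + e t om},
      strictly_stationary y & causal e y].

(* 1 - beta_1 z - ... - beta_p z^p has no root in the closed unit disc. *)
Definition stable_poly (R : realType) (p : nat) (beta : 'cV[R]_p) : Prop :=
  forall z : R[i], `|z| <= 1 ->
    1 - \sum_(i < p) (beta i 0)%:C%C * z ^+ i.+1 != 0.

Definition dist_fun (R : realType) (d : measure_display)
    (T : measurableType d) (P : probability T R) (X : {RV P >-> R}) (x : R) :
    R :=
  fine (cdf X x).

Definition has_density (R : realType) (d : measure_display)
    (T : measurableType d) (P : probability T R) (X : {RV P >-> R})
    (f : R -> R) : Prop :=
  [/\ measurable_fun setT f, forall x, 0 <= f x &
      forall A : set R, measurable A ->
        P (X @^-1` A) = (\int[lebesgue_measure]_(x in A) (f x)%:E)%E].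

Definition is_median (R : realType) (d : measure_display)
    (T : measurableType d) (P : probability T R) (X : {RV P >-> R}) (m : R) :
    Prop :=
  ((2^-1)%:E <= P (X @^-1` `]-oo, m]))%E /\
  ((2^-1)%:E <= P (X @^-1` `[m, +oo[))%E.

Definition sigma_generated (R : realType) (T : Type) (m : nat)
    (v : int -> T -> 'cV[R]_m) (I : set int) : set (set T) :=
  <<s \bigcup_(s in I)
        preimage_set_system setT (v s) (@measurable _ (borel_cV R m)) >>.

(* The set is bounded by 1 and contains 0, so [sup] is a genuine supremum. *)
Definition alpha_mixing (R : realType) (d : measure_display)
    (T : measurableType d) (P : probability T R) (m : nat)
    (v : int -> T -> 'cV[R]_m) (l : nat) : R :=
  sup [set x : R | exists (t : int) (A B : set T),
    [/\ sigma_generated v [set s | s <= t] A,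
        sigma_generated v [set s | t + l%:Z <= s] B &
        x = `|fine (P (A `&` B)) - fine (P A) * fine (P B)|]].

Definition strong_mixing (R : realType) (d : measure_display)
    (T : measurableType d) (P : probability T R) (m : nat)
    (v : int -> T -> 'cV[R]_m) : Prop :=
  alpha_mixing P v @ \oo --> (0 : R).

Definition avec (R : realType) (p q : nat) (phi : 'cV[R]_p -> 'cV[R]_q)
    (x : 'cV[R]_p) : 'cV[R]_(p + q) := col_mx x (phi x).

Definition astar (R : realType) (p q : nat) (w : 'cV[R]_p -> R)
    (phi : 'cV[R]_p -> 'cV[R]_q) (x : 'cV[R]_p) : 'cV[R]_(p + q) :=
  w x *: avec phi x.

(* The moment function g_t(beta). *)
Definition gmom (R : realType) (T : Type) (p q : nat) (w : 'cV[R]_p -> R)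
    (phi : 'cV[R]_p -> 'cV[R]_q) (y : int -> T -> R) (t : int)
    (beta : 'cV[R]_p) (om : T) : 'cV[R]_(p + q) :=
  let X := lags p y (t - 1) om in
  (2^-1 - (y t om - dotp X beta <= 0)%R%:R) *: astar w phi X.

Definition second_moment (R : realType) (d : measure_display)
    (T : measurableType d) (P : probability T R) (m : nat)
    (Z : T -> 'cV[R]_m) : 'M[R]_m :=
  \matrix_(i, j) fine ('E_P[fun om => Z om i 0 * Z om j 0]).

(* The index [i : 'I_n] stands for the time i + 1, so [(i < k)%N] selects the
   times 1, ..., k. *)
Definition el_weights (R : realType) (n m k : nat) (g1 g2 : 'I_n -> 'cV[R]_m) :
    set ('I_n -> R) :=
  [set v | [/\ forall i, 0 <= v i <= 1,
               \sum_(i < n | (i < k)%N) v i = 1,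
               \sum_(i < n | (k <= i)%N) v i = 1,
               \sum_(i < n | (i < k)%N) v i *: g1 i = 0 &
               \sum_(i < n | (k <= i)%N) v i *: g2 i = 0]].

(* [sup set0 = 0], and [lne] sends 0 to -oo. *)
Definition neg_log_el (R : realType) (n m k : nat)
    (g1 g2 : 'I_n -> 'cV[R]_m) : \bar R :=
  (- lne (sup [set (\prod_(i < n | (i < k)%N) (k%:R * v i)) *
                   (\prod_(i < n | (k <= i)%N) ((n - k)%N%:R * v i))
              | v in el_weights k g1 g2])%:E)%E.

(* The statistic l_(n,k)(theta1, theta2) at the sample point [om]. *)
Definition el_stat (R : realType) (T : Type) (p q : nat) (w : 'cV[R]_p -> R)
    (phi : 'cV[R]_p -> 'cV[R]_q) (y : int -> T -> R) (n k : nat)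
    (theta1 theta2 : 'cV[R]_p) (om : T) : \bar R :=
  neg_log_el k (fun i : 'I_n => gmom w phi y i.+1%:Z theta1 om)
               (fun i : 'I_n => gmom w phi y i.+1%:Z theta2 om).

Definition is_mele (R : realType) (T : Type) (p q : nat) (w : 'cV[R]_p -> R)
    (phi : 'cV[R]_p -> 'cV[R]_q) (y : int -> T -> R) (B : set 'cV[R]_p)
    (n k : nat) (om : T) (b : 'cV[R]_p) : Prop :=
  B b /\ (- el_stat w phi y n k b b om =
          ereal_sup [set - el_stat w phi y n k b' b' om | b' in B])%E.

(* Z_n = O_p(c_n) *)
Definition bigOp (R : realType) (d : measure_display) (T : measurableType d)
    (P : probability T R) (m : nat) (Z : nat -> T -> 'cV[R]_m)
    (c : nat -> R) : Prop :=
  forall eps : R, 0 < eps -> exists2 M : R, 0 < M &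
    \forall n \near \oo,
      (P [set om | M * c n < norm2 (Z n om)]%R <= eps%:E)%E.

(* Main.v *)
(** The proof bounds the empirical likelihood directly, without its dual.

    At the truth, the weights proportional to [1 - u'g_i], where [u] solves
    [(\sum g_i g_i') u = \sum g_i], are feasible in both blocks.  The scores are
    martingale differences, so [\sum g_i] is of order [sqrt n] and the likelihood
    ratio at [beta0] stays away from 0.

    At [b = beta0 + rho u] with [|u| = 1], weak duality (arithmetic-geometric
    mean) with the multiplier [-u / sqrt k] in the first [p] coordinates bounds
    the likelihood ratio of the first block by
    [exp (O(1) - k^(-1/2) \sum h_i)], where
    [h_i = w u'X_i (1{e_i <= rho u'X_i} - 1/2)].  Each [h_i] is nondecreasing in
    [rho], so it is enough to look at the sphere [rho = M / sqrt n]; there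
    [\sum h_i] is at least [c M sqrt n - O(sqrt n)], uniformly in [u] by a finite
    grid, because [P(0 < e <= s)] is of order [s] and mixing makes the
    frequencies of [|u'a*| > tau] bounded below.  For [M] large the value at [b]
    is smaller than the value at [beta0], which excludes the maximizer. *)

Require Import Defs.
From mathcomp Require Import all_boot all_order all_algebra.
From mathcomp Require Import complex.
From mathcomp Require Import ring lra.
From mathcomp Require Import all_classical all_reals all_analysis.
From mathcomp Require Import measurable_realfun.

Set Implicit Arguments.
Unset Strict Implicit.
Unset Printing Implicit Defensive.

Import Order.TTheory GRing.Theory Num.Theory.
Import numFieldTopology.Exports numFieldNormedType.Exports.

Local Open Scope classical_set_scope.
Local Open Scope ring_scope.

(** * Euclidean inner product and norm *)

Section Euclid.
Context {R : realType}.
Implicit Types n : nat.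

(** The indicator makes the moment function discontinuous in the parameter, so the statistic cannot
    be Taylor expanded. Only two facts about the supremum are used: explicit weights bound it from
    below, and an explicit multiplier bounds it from above. The multiplier has length [k^(-1/2)]
    because its quadratic cost [(1/k) \sum h_i^2] is then bounded through second moments, while a
    drift of order [M sqrt n] puts a term of order [- M] into the exponent. Away from the truth only
    the first block is estimated, the second factor being at most 1; at the truth both blocks must
    be controlled. Monotonicity along rays replaces a uniform law over the parameter set and a
    separate consistency step. One Chebyshev bound serves two kinds of dependence: centred functions
    of [e_t] times functions of the past are orthogonal, and indicators of events in [v_t] have
    covariances bounded by mixing coefficients. All stochastic constants are fixed before [M], so
    that [M] can be chosen last. *)

Lemma dotpE n (x y : 'cV[R]_n) : dotp x y = \sum_i x i 0 * y i 0.
Proof. by rewrite /dotp mxE; apply: eq_bigr => i _; rewrite mxE. Qed.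

Lemma dotpC n (x y : 'cV[R]_n) : dotp x y = dotp y x.
Proof. by rewrite !dotpE; apply: eq_bigr => i _; rewrite mulrC. Qed.

Lemma dotpDl n (x y z : 'cV[R]_n) : dotp (x + y) z = dotp x z + dotp y z.
Proof. by rewrite /dotp linearD mulmxDl mxE. Qed.

Lemma dotpZl n a (x z : 'cV[R]_n) : dotp (a *: x) z = a * dotp x z.
Proof. by rewrite /dotp linearZ -scalemxAl mxE. Qed.

Lemma dotpBl n (x y z : 'cV[R]_n) : dotp (x - y) z = dotp x z - dotp y z.
Proof. by rewrite dotpDl -scaleN1r dotpZl mulN1r. Qed.

Lemma dotpZr n a (x z : 'cV[R]_n) : dotp x (a *: z) = a * dotp x z.
Proof. by rewrite dotpC dotpZl dotpC. Qed.

Lemma dotpBr n (x y z : 'cV[R]_n) : dotp z (x - y) = dotp z x - dotp z y.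
Proof. by rewrite dotpC dotpBl !(dotpC z). Qed.

Lemma dotp_sumr n (I : finType) (A : pred I) (u : 'cV[R]_n)
    (g : I -> 'cV[R]_n) :
  dotp u (\sum_(i | A i) g i) = \sum_(i | A i) dotp u (g i).
Proof. by rewrite /dotp mulmx_sumr summxE. Qed.

Lemma norm2_ge0 n (x : 'cV[R]_n) : 0 <= norm2 x.
Proof. exact: sqrtr_ge0. Qed.

Lemma sqr_norm2 n (x : 'cV[R]_n) : norm2 x ^+ 2 = dotp x x.
Proof.
rewrite sqr_sqrtr; last by apply: sumr_ge0 => i _; exact: sqr_ge0.
by rewrite dotpE; apply: eq_bigr => i _; rewrite expr2.
Qed.

Lemma norm2_eq0 n (x : 'cV[R]_n) : norm2 x = 0 -> x = 0.
Proof.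
move=> x0; have : dotp x x = 0 by rewrite -sqr_norm2 x0 expr0n.
rewrite dotpE => /eqP; rewrite psumr_eq0; last by move=> i _; rewrite -expr2 sqr_ge0.
move=> /allP h; apply/colP => i; rewrite mxE.
by have := h i (mem_index_enum i); rewrite /= mulf_eq0 orbb => /eqP.
Qed.

Lemma norm2Z n a (x : 'cV[R]_n) : norm2 (a *: x) = `|a| * norm2 x.
Proof.
rewrite /norm2 -sqrtr_sqr -sqrtrM ?sqr_ge0// mulr_sumr; congr Num.sqrt.
by apply: eq_bigr => i _; rewrite mxE exprMn.
Qed.

Lemma ler_coord_norm2 n (x : 'cV[R]_n) i : `|x i 0| <= norm2 x.
Proof.
rewrite -sqrtr_sqr ler_wsqrtr// (bigD1 i)//= lerDl.
by apply: sumr_ge0 => j _; exact: sqr_ge0.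
Qed.

Lemma norm2_le_sum n (x : 'cV[R]_n) : norm2 x <= \sum_i `|x i 0|.
Proof.
have s0 : 0 <= \sum_i `|x i 0| by apply: sumr_ge0.
rewrite -(ger0_norm s0) -sqrtr_sqr ler_wsqrtr//.
have : forall (s : seq 'I_n), \sum_(i <- s) x i 0 ^+ 2 <= (\sum_(i <- s) `|x i 0|) ^+ 2.
  elim=> [|i s ih]; first by rewrite !big_nil expr0n.
  rewrite !big_cons sqrrD -[x i 0 ^+ 2]real_normK ?num_real// -addrA lerD2l.
  apply: le_trans ih _; rewrite lerDr mulrn_wge0// mulr_ge0//.
  by apply: sumr_ge0.
exact.
Qed.

Lemma CauchySchwarz_dotp n (x y : 'cV[R]_n) : `|dotp x y| <= norm2 x * norm2 y.
Proof.
have key (z : 'cV[R]_n) : dotp z y <= norm2 z * norm2 y.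
  have [/norm2_eq0 ->|z0] := eqVneq (norm2 z) 0.
    rewrite -(scale0r (0 : 'cV[R]_n)) dotpZl mul0r.
    by rewrite mulr_ge0// norm2_ge0.
  have [/norm2_eq0 ->|y0] := eqVneq (norm2 y) 0.
    rewrite dotpC -(scale0r (0 : 'cV[R]_n)) dotpZl mul0r.
    by rewrite mulr_ge0// norm2_ge0.
  have zp : 0 < norm2 z by rewrite lt_def z0 norm2_ge0.
  have yp : 0 < norm2 y by rewrite lt_def y0 norm2_ge0.
  (* Expanded, this square is twice the product of the norms times the deficit in the inequality. *)
  have := sqr_ge0 (norm2 (norm2 y *: z - norm2 z *: y)).
  rewrite sqr_norm2 dotpBl !dotpBr !dotpZl !dotpZr (dotpC y z) -!sqr_norm2.
  move=> h; have : 0 <= (norm2 y * norm2 z) * (norm2 z * norm2 y - dotp z y) by nra.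
  by rewrite pmulr_rge0 ?mulr_gt0// subr_ge0.
rewrite ler_norml key andbT lerNl -mulN1r -dotpZl.
by apply: le_trans (key _) _; rewrite norm2Z normrN1 mul1r.
Qed.

Lemma dist_dotp_le n (x y a : 'cV[R]_n) (h : R) :
  (forall i, `|x i 0 - y i 0| <= h) ->
  `|dotp x a - dotp y a| <= h * \sum_i `|a i 0|.
Proof.
move=> xy; rewrite -dotpBl dotpE mulr_sumr; apply: le_trans (ler_norm_sum _ _ _) _.
by apply: ler_sum => i _; rewrite normrM !mxE ler_wpM2r.
Qed.

End Euclid.

(** * Bounds on the empirical likelihood ratio *)

Section EmpiricalLikelihood.
Context {R : realType}.

(** Follows from [(1 - x)(1 + x + 2x^2) = 1 + x^2 (1 - 2x) >= 1] and [1 + t <= expR t]. It serves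
    both directions: with [x = - h i] in the upper bound on the likelihood and with [x = u'g_i] in
    the lower one. *)
Lemma expR_quadratic_le (x : R) : x <= 2^-1 -> expR (- x - 2 * x ^+ 2) <= 1 - x.
Proof.
move=> x2.
have e0 := expR_gt0 (x + 2 * x ^+ 2).
have e1 := expR_ge1Dx (x + 2 * x ^+ 2).
rewrite -opprD expRN -[leLHS]mul1r ler_pdivrMr//.
have : 1 <= (1 - x) * (1 + (x + 2 * x ^+ 2)).
  have : 0 <= x ^+ 2 * (1 - 2 * x) by rewrite mulr_ge0 ?sqr_ge0//; lra.
  nra.
move=> /le_trans; apply; rewrite ler_wpM2l//; lra.
Qed.

Variables (I : finType) (A : pred I).
Let k := #|A|.

(** The factors have arithmetic mean 1. *)
Lemma prod_scaled_weights_le1 (v : I -> R) :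
  (forall i, A i -> 0 <= v i) -> \sum_(i | A i) v i = 1 ->
  \prod_(i | A i) (k%:R * v i) <= 1.
Proof.
move=> v0 v1.
have k0 : (0 < k)%N.
  rewrite lt0n; apply/eqP => /card0_eq k0; move: v1; rewrite big_pred0//.
  by move=> /eqP; rewrite eq_sym oner_eq0.
have [] := @leif_AGM R I A (fun i => k%:R * v i); first by move=> i /v0 ?; rewrite mulr_ge0.
move=> /le_trans + _; apply.
by rewrite -mulr_sumr v1 mulr1 divff ?expr1n// pnatr_eq0 -lt0n.
Qed.

(* Weak duality: [v i * (1 + h i)] are again weights. *)
Lemma prod_scaled_weights_le_expR (v h : I -> R) :
  (forall i, A i -> 0 <= v i) -> \sum_(i | A i) v i = 1 ->
  \sum_(i | A i) v i * h i = 0 -> (forall i, A i -> - 2^-1 <= h i) ->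
  \prod_(i | A i) (k%:R * v i) <=
    expR (2 * \sum_(i | A i) h i ^+ 2 - \sum_(i | A i) h i).
Proof.
move=> v0 v1 vh hge.
have h0 i : A i -> 0 < 1 + h i by move=> /hge; lra.
have P0 : 0 <= \prod_(i | A i) (k%:R * v i).
  by apply: prodr_ge0 => i /v0 ?; rewrite mulr_ge0.
have H : \prod_(i | A i) (k%:R * v i) * \prod_(i | A i) (1 + h i) <= 1.
  rewrite -big_split/=; under eq_bigr do rewrite -mulrA.
  apply: prod_scaled_weights_le1.
    by move=> i Ai; rewrite mulr_ge0 ?v0// ltW// h0.
  by under eq_bigr do rewrite mulrDr mulr1; rewrite big_split/= v1 vh addr0.
have E : expR (\sum_(i | A i) (h i - 2 * h i ^+ 2)) <= \prod_(i | A i) (1 + h i).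
  rewrite expR_sum; apply: ler_prod => i Ai; rewrite expR_ge0/=.
  have := @expR_quadratic_le (- h i); rewrite opprK sqrrN; apply.
  by have := hge _ Ai; lra.
have -> : 2 * \sum_(i | A i) h i ^+ 2 - \sum_(i | A i) h i =
    - \sum_(i | A i) (h i - 2 * h i ^+ 2).
  by rewrite big_split/= sumrN mulr_sumr opprD opprK addrC.
rewrite expRN -[leRHS]mul1r ler_pdivlMr ?expR_gt0//.
by apply: le_trans H; rewrite ler_wpM2l.
Qed.

(* The weights are proportional to [1 - u'g_i], with [u] solving
   [(\sum g_i g_i') u = \sum g_i]. *)
Lemma prod_scaled_weights_ge_expR m (g : I -> 'cV[R]_m) (c Z mu : R) :
  (0 < k)%N -> 0 < c -> 0 <= Z -> 0 <= mu ->
  (forall u, c * k%:R * norm2 u ^+ 2 <= \sum_(i | A i) dotp u (g i) ^+ 2) ->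
  norm2 (\sum_(i | A i) g i) <= Z * Num.sqrt k%:R ->
  (forall i, A i -> norm2 (g i) <= mu * Num.sqrt k%:R) ->
  Z * mu / c <= 2^-1 ->
  exists v : I -> R, [/\ forall i, A i -> 0 <= v i <= 1,
    \sum_(i | A i) v i = 1, \sum_(i | A i) v i *: g i = 0 &
    expR (- (3 * Z ^+ 2 / c)) <= \prod_(i | A i) (k%:R * v i)].
Proof.
move=> k_gt0 c0 Z0 mu0 Gpd gZ gmu Zmu.
have kR0 : 0 < k%:R :> R by rewrite ltr0n.
pose rk : R := Num.sqrt k%:R.
have rk0 : 0 < rk by rewrite sqrtr_gt0.
have rk2 : rk ^+ 2 = k%:R by rewrite sqr_sqrtr// ltW.
pose G : 'M[R]_m := \sum_(i | A i) g i *m (g i)^T.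
pose s := \sum_(i | A i) g i.
have dotG u x : dotp u (G *m x) = \sum_(i | A i) dotp u (g i) * dotp (g i) x.
  rewrite /dotp /G mulmx_suml mulmx_sumr summxE; apply: eq_bigr => i _.
  by rewrite -mulmxA mulmxA [LHS]mxE big_ord1.
have Gsym : G^T = G.
  rewrite /G linear_sum/=; apply: eq_bigr => i _.
  by rewrite trmx_mul trmxK.
have Gunit : G \in unitmx.
  rewrite unitmxE unitfE; apply/det0P => -[x x0 xG].
  have xT : x^T != 0 by apply: contra x0 => /eqP h; rewrite -(trmxK x) h linear0.
  have Gx : G *m x^T = 0 by rewrite -Gsym -trmx_mul xG linear0.
  have := Gpd x^T; have -> : \sum_(i | A i) dotp x^T (g i) ^+ 2 = 0.
    transitivity (dotp x^T (G *m x^T)).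
      by rewrite dotG; apply: eq_bigr => i _; rewrite expr2 (dotpC (g i)).
    by rewrite Gx /dotp mulmx0 mxE.
  rewrite pmulr_rle0 ?mulr_gt0// => h.
  have /eqP : norm2 x^T ^+ 2 = 0 by apply/eqP; rewrite eq_le h sqr_ge0.
  by rewrite sqrf_eq0 => /eqP/norm2_eq0; apply/eqP.
pose u := invmx G *m s.
have Gu : G *m u = s by rewrite /u mulmxA mulmxV// mul1mx.
pose us := dotp u s.
have usE : us = \sum_(i | A i) dotp u (g i) ^+ 2.
  by rewrite /us -Gu dotG; apply: eq_bigr => i _; rewrite expr2 (dotpC (g i)).
have usE' : us = \sum_(i | A i) dotp u (g i) by rewrite /us /s dotp_sumr.
have us0 : 0 <= us by rewrite usE; apply: sumr_ge0 => i _; exact: sqr_ge0.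
have us_le : us <= norm2 u * (Z * rk).
  rewrite (le_trans (ler_norm _))// (le_trans (CauchySchwarz_dotp _ _))//.
  by rewrite ler_wpM2l ?norm2_ge0.
(* From [c k |u|^2 <= u'Gu = u's <= |u| Z sqrt k]: the solution [u] is of order [k^(-1/2)]. *)
have u_le : norm2 u * (c * rk) <= Z.
  have h1 : c * k%:R * norm2 u ^+ 2 <= norm2 u * (Z * rk).
    by apply: le_trans us_le; rewrite usE.
  have [->|u0] := eqVneq (norm2 u) 0; first by rewrite mul0r.
  have up : 0 < norm2 u by rewrite lt_def u0 norm2_ge0.
  rewrite -(ler_pM2l (mulr_gt0 up rk0)).
  apply: le_trans (le_trans h1 _); last by rewrite le_eqVlt; apply/orP; left; apply/eqP; ring.
  by rewrite -rk2 le_eqVlt; apply/orP; left; apply/eqP; ring.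
have us_Z : us <= Z ^+ 2 / c.
  rewrite ler_pdivlMr// (le_trans (ler_wpM2r (ltW c0) us_le))//.
  by have := ler_wpM2l Z0 u_le; nra.
(* Since [|u| <= Z / (c sqrt k)] and [|g_i| <= mu sqrt k], the product is at most [Z mu / c]; this
   keeps every weight positive and allows [expR_quadratic_le]. *)
have ug i : A i -> `|dotp u (g i)| <= 2^-1.
  move=> Ai; apply: le_trans (CauchySchwarz_dotp _ _) _; apply: le_trans Zmu.
  rewrite ler_pdivlMr//.
  apply: (@le_trans _ _ (norm2 u * (mu * rk) * c)).
    by rewrite ler_wpM2r ?(ltW c0)// ler_wpM2l ?norm2_ge0// gmu.
  by have := ler_wpM2r mu0 u_le; nra.
pose D : R := k%:R - us.
have sum1 : \sum_(i | A i) (1 - dotp u (g i)) = D.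
  by rewrite big_split/= sumrN -usE' sumr_const.
have D0 : 0 < D.
  rewrite -sum1; apply: (@lt_le_trans _ _ (\sum_(i | A i) (2^-1 : R))).
    by rewrite sumr_const -[X in 0 < X *+ _]mul1r -mulrnAr mul1r pmulrn_rgt0// invr_gt0.
  by apply: ler_sum => i /ug; rewrite ler_norml => /andP[_]; lra.
pose v i := (1 - dotp u (g i)) / D.
have v0 i : A i -> 0 <= v i.
  by move=> /ug; rewrite ler_norml => /andP[_] h; rewrite divr_ge0// ?ltW//; lra.
have v1 : \sum_(i | A i) v i = 1 by rewrite -mulr_suml sum1 divff// gt_eqF.
exists v; split=> //.
- move=> i Ai; rewrite v0//= -v1 (bigD1 i)//= lerDl.
  by apply: sumr_ge0 => j /andP[/v0].
- have -> : \sum_(i | A i) v i *: g i = D^-1 *: (s - G *m u).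
    rewrite /G mulmx_suml -sumrB scaler_sumr; apply: eq_bigr => i _.
    rewrite /v mulrC -scalerA scalerBl scale1r; congr (_ *: (_ - _)).
    apply/colP => j; rewrite -mulmxA !mxE big_ord1 mulrC; congr (_ * _).
    by rewrite dotpC.
  by rewrite Gu subrr scaler0.
(* The normalization [D = k - us] is at most [k], so [k * v i >= 1 - u'g_i]. Both [\sum u'g_i] and
   [\sum (u'g_i)^2] equal [us], whence the factor 3. *)
apply: (@le_trans _ _ (expR (\sum_(i | A i) (- dotp u (g i) - 2 * dotp u (g i) ^+ 2)))).
  rewrite ler_expR big_split/= !sumrN -usE' -mulr_sumr -usE.
  have -> : 3 * Z ^+ 2 / c = 3 * (Z ^+ 2 / c) by rewrite mulrA.
  by move: us_Z; lra.
rewrite expR_sum; apply: ler_prod => i Ai; rewrite expR_ge0/=.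
have := ug _ Ai; rewrite ler_norml => /andP[_ h].
apply: le_trans (expR_quadratic_le h) _.
rewrite mulrCA -[leLHS]mulr1 ler_wpM2l//; first lra.
by rewrite ler_pdivlMr// mul1r /D gerBl.
Qed.

End EmpiricalLikelihood.

Section ELStatistic.
Context {R : realType}.
Variables (n m k : nat).
Implicit Types g : 'I_n -> 'cV[R]_m.

Definition el_product (v : 'I_n -> R) : R :=
  \prod_(i < n | (i < k)%N) (k%:R * v i) *
  \prod_(i < n | (k <= i)%N) ((n - k)%N%:R * v i).

Definition el_sup g1 g2 : R := sup (el_product @` el_weights k g1 g2).

Hypothesis kn : (k <= n)%N.

Lemma card_first_block : #|[pred i : 'I_n | (i < k)%N]| = k.
Proof.
rewrite -sum1_card (eq_bigl (fun i : 'I_n => (i < k)%N))//.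
by rewrite -(big_ord_widen _ (fun=> 1%N) kn) sum_nat_const card_ord muln1.
Qed.

Lemma card_second_block : #|[pred i : 'I_n | (k <= i)%N]| = (n - k)%N.
Proof.
have := cardC [pred i : 'I_n | (i < k)%N]; rewrite card_first_block card_ord.
move=> /(canRL (addKn _)) <-; apply: eq_card => i.
by rewrite !inE -leqNgt.
Qed.

Lemma second_block_le1 g1 g2 v : el_weights k g1 g2 v ->
  \prod_(i < n | (k <= i)%N) ((n - k)%N%:R * v i) <= 1.
Proof.
move=> [v01 _ v1 _ _].
have := @prod_scaled_weights_le1 R _ [pred i : 'I_n | (k <= i)%N] v.
by rewrite card_second_block; apply => // i _; case/andP: (v01 i).
Qed.

Lemma first_block_le1 g1 g2 v : el_weights k g1 g2 v ->
  \prod_(i < n | (i < k)%N) (k%:R * v i) <= 1.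
Proof.
move=> [v01 v1 _ _ _].
have := @prod_scaled_weights_le1 R _ [pred i : 'I_n | (i < k)%N] v.
by rewrite card_first_block; apply => // i _; case/andP: (v01 i).
Qed.

(** Lets the exclusion of distant parameters work with the first block alone. *)
Lemma el_product_le_first g1 g2 v : el_weights k g1 g2 v ->
  el_product v <= \prod_(i < n | (i < k)%N) (k%:R * v i).
Proof.
move=> gv; rewrite /el_product -[leRHS]mulr1 ler_wpM2l//.
  by case: gv => v01 *; apply: prodr_ge0 => i _; rewrite mulr_ge0//; case/andP: (v01 i).
exact: second_block_le1 gv.
Qed.

Lemma el_sup_ge g1 g2 v : el_weights k g1 g2 v -> el_product v <= el_sup g1 g2.
Proof.
move=> gv; apply: ub_le_sup; last by exists v.
exists 1 => _ [v' gv' <-]; apply: le_trans (el_product_le_first gv') _.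
exact: first_block_le1 gv'.
Qed.

Lemma el_sup_le g1 g2 b : 0 <= b ->
  (forall v, el_weights k g1 g2 v -> el_product v <= b) -> el_sup g1 g2 <= b.
Proof.
move=> b0 h; have [e|/set0P e] := eqVneq (el_product @` el_weights k g1 g2) set0.
  by rewrite /el_sup e sup0.
by apply: ge_sup => // _ [v /h + <-].
Qed.

(** Positivity on the left puts [lne] in its strictly increasing range; on the right the supremum
    may be 0, where [lne] is -oo and the assumed inequality fails. *)
Lemma neg_log_el_le g1 g2 g1' g2' : 0 < el_sup g1 g2 ->
  (- neg_log_el k g1 g2 <= - neg_log_el k g1' g2')%E ->
  el_sup g1 g2 <= el_sup g1' g2'.
Proof.
move=> p0; rewrite /neg_log_el !oppeK -/(el_sup g1 g2) -/(el_sup g1' g2') => h.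
rewrite leNgt; apply/negP => lt; move: h; apply/negP; rewrite -ltNge.
have [q0|q0] := ltP 0 (el_sup g1' g2').
  by rewrite !lne_EFin// lte_fin ltr_ln.
by rewrite le0_lneNy ?lee_fin// lne_EFin// ltNyr.
Qed.

End ELStatistic.

(** * Borel structure of column vectors *)

Section BorelVectors.
Context {R : realType}.

Lemma measurable_coord n (i : 'I_n) :
  measurable_fun [set: borel_cV R n] (fun x : borel_cV R n => (x : 'cV[R]_n) i 0).
Proof.
apply: (measurability _ (RGenOInfty.measurableE R)) => _ [_ [a ->] <-].
rewrite setTI; apply: sub_sigma_algebra.
apply: open_comp; last exact: rray_open.
by move=> x _; exact: coord_continuous.
Qed.

(* An open set is the union of the countably many sup-norm balls with rational
   centre and radius [1/(k+1)] that it contains. *)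
Lemma measurable_borel_cV d (T : measurableType d) n (f : T -> 'cV[R]_n) :
  (forall i, measurable_fun [set: T] (fun t => f t i 0)) ->
  measurable_fun [set: T] (f : T -> borel_cV R n).
Proof.
move=> mf; apply: (measurability _ (erefl (@measurable _ (borel_cV R n)))).
move=> _ [U oU <-]; rewrite setTI.
pose bx (ck : 'cV[rat]_n * nat) : set 'cV[R]_n :=
  [set x | forall i, `|ratr (ck.1 i 0) - x i 0| < ck.2.+1%:R^-1].
have -> : f @^-1` U = \bigcup_(ck in [set: 'cV[rat]_n * nat])
    (if `[< bx ck `<=` U >] then f @^-1` (bx ck) else set0).
  apply/seteqP; split => t /=; last first.
    by move=> [ck _]; case: asboolP => // h /h.
  move=> Uft; have /nbhs_ballP [e /= e0 eU] : nbhs (f t) U by exact: open_nbhs_nbhs.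
  (* The radius is below [e / 2], so a box containing [f t] lies inside the [e]-ball around it. *)
  pose k := Num.truncn (2 / e).
  have ke : k.+1%:R^-1 < e / 2.
    have h2 : 0 < 2 / e by rewrite divr_gt0.
    rewrite -[e / 2]invrK invf_div ltf_pV2 ?posrE//.
    exact: truncnS_gt.
  have dense (x : R) : exists q : rat, `|ratr q - x| < k.+1%:R^-1.
    have k0 : x - k.+1%:R^-1 < x + k.+1%:R^-1.
      by rewrite ltrD2l gtrN// invr_gt0.
    have [q] := rat_in_itvoo k0; rewrite in_itv/= => /andP[q1 q2].
    by exists q; rewrite ltr_distl q1 q2.
  pose c : 'cV[rat]_n := \col_i sval (cid (dense (f t i 0))).
  exists (c, k) => //; case: asboolP => [_ i|[]] /=.
    by rewrite mxE; case: cid.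
  move=> x xc; apply: eU; split=> // i j; rewrite !(ord1 j).
  rewrite /ball/= (_ : f t i 0 - x i 0 =
    (ratr (c i 0) - x i 0) - (ratr (c i 0) - f t i 0)); last by ring.
  apply: le_lt_trans (ler_normB _ _) _; rewrite [e]splitr ltrD//.
    exact: lt_trans (xc i) ke.
  by rewrite mxE; case: cid => q /= /lt_trans; apply.
apply: countable_bigcupT_measurable => [|ck]; first exact: countableP.
case: ifP => // _.
have -> : f @^-1` bx ck = \bigcap_(i in [set: 'I_n])
    [set t | `|ratr (ck.1 i 0) - f t i 0| < ck.2.+1%:R^-1].
  by apply/seteqP; split => t h i; [move=> _|]; exact: h.
apply: fin_bigcap_measurable => // i _.
have mg : measurable_fun setT (fun t => `|ratr (ck.1 i 0) - f t i 0|).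
  by apply: measurableT_comp => //; apply: measurable_funB.
have := mg measurableT `]-oo, ck.2.+1%:R^-1[%classic (measurable_itv _).
by rewrite setTI.
Qed.

Lemma measurable_cV_coord d (T : measurableType d) n (f : T -> 'cV[R]_n) i :
  measurable_fun [set: T] (f : T -> borel_cV R n) ->
  measurable_fun [set: T] (fun t => f t i 0).
Proof.
by move=> mf; exact: (measurableT_comp (@measurable_coord n i) mf).
Qed.

Lemma measurable_norm2 n :
  measurable_fun [set: borel_cV R n] (fun x : borel_cV R n => norm2 (x : 'cV[R]_n)).
Proof.
have msqrt : measurable_fun setT (@Num.sqrt R).
  by apply: continuous_measurable_fun; exact: sqrt_continuous.
apply: (measurableT_comp msqrt).
apply: measurable_sum => i; apply: measurable_funX; exact: measurable_coord.
Qed.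

Lemma measurable_dotp n (u : 'cV[R]_n) :
  measurable_fun [set: borel_cV R n] (fun x : borel_cV R n => dotp u (x : 'cV[R]_n)).
Proof.
under eq_fun do rewrite dotpE.
apply: measurable_sum => i; apply: measurable_funM => //; exact: measurable_coord.
Qed.

(** A pi-system generating the Borel sets, of the shape on which [strictly_stationary] is tested;
    uniqueness of measures then extends equality of laws to all Borel sets. *)
Definition boxes n : set (set 'cV[R]_n) :=
  [set A | exists B : 'I_n -> set R,
     (forall i, measurable (B i)) /\
     A = [set x : 'cV[R]_n | forall i, B i (x i 0)]].

Lemma boxes_setI n : setI_closed (@boxes n).
Proof.
move=> _ _ [B1 [mB1 ->]] [B2 [mB2 ->]]; exists (fun i => B1 i `&` B2 i); split.
  by move=> i; exact: measurableI.
by apply/seteqP; split => [x [h1 h2] i //|x h]; split => i; case: (h i).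
Qed.

Lemma borel_cV_boxes n : @measurable _ (borel_cV R n) = <<s @boxes n >>.
Proof.
apply/seteqP; split.
  have mid : measurable_fun [set: g_sigma_algebraType (@boxes n)]
      (fun x : g_sigma_algebraType (@boxes n) => (x : borel_cV R n)).
    apply: measurable_borel_cV => i _ B mB; rewrite setTI.
    apply: sub_sigma_algebra; exists (fun j => if j == i then B else setT).
    split; first by move=> j; case: ifP.
    apply/seteqP; split => x /=; first by move=> Bx j; case: eqP => [->|].
    by move=> /(_ i); rewrite eqxx.
  by move=> A mA; have := mid measurableT A mA; rewrite setTI.
apply: smallest_sub; first exact: sigma_algebra_measurable.
move=> _ [B [mB ->]].
have -> : [set x : 'cV[R]_n | forall i, B i (x i 0)] =
    \bigcap_(i in [set: 'I_n]) ((fun x : 'cV[R]_n => x i 0) @^-1` B i).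
  by apply/seteqP; split => x h i; [move=> _|]; exact: h.
apply: (@fin_bigcap_measurable _ (borel_cV R n)) => // i _.
by rewrite -[X in measurable X]setTI; exact: (@measurable_coord n i measurableT).
Qed.

Lemma eq_law_boxes d (T : measurableType d) (P : probability T R) n
    (X Y : T -> 'cV[R]_n) :
  measurable_fun [set: T] (X : T -> borel_cV R n) ->
  measurable_fun [set: T] (Y : T -> borel_cV R n) ->
  (forall A, boxes A -> P (X @^-1` A) = P (Y @^-1` A)) ->
  forall A, @measurable _ (borel_cV R n) A -> P (X @^-1` A) = P (Y @^-1` A).
Proof.
move=> mX mY XY A mA.
pose mu : {measure set (borel_cV R n) -> \bar R} := [the {measure set _ -> \bar R} of
   distribution P (mfun_Sub (mem_set mX))].
pose nu : {measure set (borel_cV R n) -> \bar R} := [the {measure set _ -> \bar R} of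
   distribution P (mfun_Sub (mem_set mY))].
have -> : P (X @^-1` A) = mu A by [].
have -> : P (Y @^-1` A) = nu A by [].
apply: (@measure_unique _ R (borel_cV R n) (@boxes n) (fun=> setT)) => //.
- exact: borel_cV_boxes.
- exact: boxes_setI.
- move=> _; exists (fun=> setT); split => //.
  by apply/seteqP; split.
- by apply/seteqP; split => // x _; exists 0%N.
- move=> _; rewrite (le_lt_trans _ (ltry 1))//; exact: probability_le1.
Qed.

End BorelVectors.

(** * Independence of an innovation and the past *)

Lemma bigsetI_seqP (T : Type) (I : choiceType) (s : seq I) (F : I -> set T) (x : T) :
  (\big[setI/setT]_(i <- s) F i) x <-> (forall i, i \in s -> F i x).
Proof. by rewrite -bigcap_seq; split => h i; exact: h. Qed.

(** A pi-system generating the sigma-algebra of the innovations before [t], made of the finite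
    intersections to which the product rule applies. *)
Definition past_cylinders (R : realType) (T : Type) (e : int -> T -> R)
    (t : int) : set (set T) :=
  [set A | exists (s : seq int) (B : int -> set R),
    [/\ uniq s, forall u, u \in s -> u < t, forall u, measurable (B u) &
        A = \big[setI/setT]_(u <- s) (e u @^-1` B u)]].

Lemma past_cylinders_setI (R : realType) (T : Type) (e : int -> T -> R) t :
  setI_closed (past_cylinders e t).
Proof.
move=> _ _ [s1 [B1 [us1 lt1 mB1 ->]]] [s2 [B2 [us2 lt2 mB2 ->]]].
pose B u := (if u \in s1 then B1 u else setT) `&` (if u \in s2 then B2 u else setT).
exists (undup (s1 ++ s2)), B; split.
- exact: undup_uniq.
- by move=> u; rewrite mem_undup mem_cat => /orP[/lt1|/lt2].
- by move=> u; apply: measurableI; case: ifP.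
apply/seteqP; split => [x [/bigsetI_seqP h1 /bigsetI_seqP h2]|x /bigsetI_seqP h].
  apply/bigsetI_seqP => u _; split.
    by case: ifP => // /h1.
  by case: ifP => // /h2.
split; apply/bigsetI_seqP => u us.
  have /h[] : u \in undup (s1 ++ s2) by rewrite mem_undup mem_cat us.
  by rewrite us.
have /h[] : u \in undup (s1 ++ s2) by rewrite mem_undup mem_cat us orbT.
by rewrite us.
Qed.

Section Past.
Context {R : realType} {d : measure_display} {T : measurableType d}.
Variable P : probability T R.

Definition past_measurable (e : int -> T -> R) (t : int) (U : T -> R) :=
  measurable_fun [set: g_sigma_algebraType (past_cylinders e t)]
    (U : g_sigma_algebraType (past_cylinders e t) -> R).

Variable e : int -> {RV P >-> R}.

Lemma past_cylinders_measurable t :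
  <<s past_cylinders e t >> `<=` @measurable _ T.
Proof.
apply: smallest_sub; first exact: sigma_algebra_measurable.
move=> _ [s [B [_ _ mB ->]]].
rewrite -bigcap_seq; apply: fin_bigcap_measurable => // u _.
by rewrite -[X in measurable X]setTI; exact: (measurable_funPT (e u)).
Qed.

Lemma past_measurable_measurable t U : past_measurable e t U ->
  measurable_fun [set: T] U.
Proof.
move=> mU _ B mB; apply: (@past_cylinders_measurable t).
exact: (mU measurableT B mB).
Qed.

Lemma past_measurable_e s t : s < t -> past_measurable e t (e s).
Proof.
move=> st _ B mB; rewrite setTI; apply: sub_sigma_algebra.
exists [:: s], (fun=> B); split => //; first by move=> u; rewrite inE => /eqP ->.
by rewrite big_seq1.
Qed.

Hypothesis e_indep : mutually_independent e.

(** As functions of [A], both sides are finite measures (a restriction and a multiple of [P]), and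
    they agree on the pi-system of cylinders. *)
Lemma past_independent t A C : <<s past_cylinders e t >> A -> measurable C ->
  (P (A `&` (e t @^-1` C)) = P (e t @^-1` C) * P A)%E.
Proof.
move=> pA mC.
have mE : measurable (e t @^-1` C).
  by rewrite -[X in measurable X]setTI; exact: (measurable_funPT (e t)).
have p0 : 0 <= fine (P (e t @^-1` C)) by rewrite fine_ge0.
have pE : P (e t @^-1` C) = (fine (P (e t @^-1` C)))%:E by rewrite fineK// fin_num_measure.
rewrite pE.
pose m1 := mrestr P mE; pose m2 := mscale (NngNum p0) P.
change (m1 A = m2 A).
apply: (@g_sigma_algebra_measure_unique _ R T (past_cylinders e t) _ (fun=> setT)) pA => //.
- by move=> B ?; apply: (@past_cylinders_measurable t); exact: sub_sigma_algebra.
- by move=> _; exists [::], (fun=> setT); split => //; rewrite big_nil.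
- by apply/seteqP; split => // x _; exists 0%N.
- exact: past_cylinders_setI.
- move=> _ [s [B [us lts mB ->]]].
  change (P ((\big[setI/setT]_(u <- s) (e u @^-1` B u)) `&` (e t @^-1` C)) =
    (fine (P (e t @^-1` C)))%:E * P (\big[setI/setT]_(u <- s) (e u @^-1` B u)))%E.
  rewrite -pE.
  (* Placing [C] at index [t], which is not in [s], turns the claim into the product rule for
     [t :: s]. *)
  pose B' u := if u == t then C else B u.
  have ts : t \notin s by apply/negP => /lts; rewrite ltxx.
  have sB : \big[setI/setT]_(u <- s) (e u @^-1` B' u) = \big[setI/setT]_(u <- s) (e u @^-1` B u).
    apply: eq_big_seq => u us'; rewrite /B'; case: eqP => // ut.
    by move: ts; rewrite -ut us'.
  have := @e_indep (t :: s) B'; rewrite !big_cons sB {1 2}/B' eqxx setIC => -> //=.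
  + rewrite {1}/B' eqxx; congr (_ * _)%E.
    by rewrite -sB e_indep// => u; rewrite /B'; case: ifP.
  + by rewrite ts.
  + by move=> u; rewrite /B'; case: ifP.
- move=> _; change (P (setT `&` (e t @^-1` C)) < +oo)%E.
  by rewrite -ge0_fin_numE// fin_num_measure//; exact: measurableI.
Qed.

(** For nonnegative [U], the law of [U] under [P] restricted to the event is a multiple of its law
    under [P], by independence on preimages; the general case splits into positive and negative
    parts. *)
Lemma integral_past_indic t U C : past_measurable e t U -> measurable C ->
  P.-integrable setT (EFin \o U) ->
  (\int[P]_(x in e t @^-1` C) (U x)%:E = P (e t @^-1` C) * \int[P]_x (U x)%:E)%E.
Proof.
move=> pU mC iU.
have mU := past_measurable_measurable pU.
have mE : measurable (e t @^-1` C).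
  by rewrite -[X in measurable X]setTI; exact: (measurable_funPT (e t)).
have p0 : 0 <= fine (P (e t @^-1` C)) by rewrite fine_ge0.
have pE : P (e t @^-1` C) = (fine (P (e t @^-1` C)))%:E by rewrite fineK// fin_num_measure.
set E := e t @^-1` C in mE p0 pE *.
have ge0_case (V : T -> R) : past_measurable e t V -> (forall x, 0 <= V x) ->
    (\int[P]_(x in E) (V x)%:E = P E * \int[P]_x (V x)%:E)%E.
  move=> pV V0; have mV := past_measurable_measurable pV.
  pose m1 : {measure set T -> \bar R} := mrestr P mE.
  pose m2 : {measure set T -> \bar R} := mscale (NngNum p0) P.
  have mV' : measurable_fun setT (EFin \o V) by exact/measurable_EFinP.
  transitivity (\int[m1]_(x in E) (V x)%:E)%E.
    apply: eq_measure_integral => A mA AE.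
    by change (P A = P (A `&` E)); rewrite setIidl.
  transitivity (\int[m1]_x (V x)%:E)%E.
    rewrite (@ge0_negligible_integral _ _ _ m1 setT (~` E))//=.
    - by rewrite setTD setCK.
    - exact: measurableC.
    - by move=> x _; rewrite lee_fin.
    - by change (P (~` E `&` E) = 0%E); rewrite setICl measure0.
  (* The change of variables wants an integrand that is nonnegative on the whole line; the absolute
     value is the identity on the range of [V]. *)
  transitivity (\int[pushforward m1 V]_y `|y|%:E)%E.
    rewrite ge0_integral_pushforward//=; last 1 first.
    - by apply/measurable_EFinP; exact: normr_measurable.
    by apply: eq_integral => x _; rewrite /= ger0_norm.
  transitivity (\int[pushforward m2 V]_y `|y|%:E)%E.
    apply: eq_measure_integral => A mA _; rewrite /pushforward/=.
    change (P ((V @^-1` A) `&` E) = (fine (P E))%:E * P (V @^-1` A))%E.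
    rewrite -pE past_independent//.
    by have := pV measurableT A mA; rewrite setTI.
  rewrite ge0_integral_pushforward//=; last 1 first.
  - by apply/measurable_EFinP; exact: normr_measurable.
  rewrite preimage_setT ge0_integral_mscale//=.
    rewrite pE; congr (_ * _)%E; apply: eq_integral => x _.
    by rewrite /= ger0_norm.
  by apply/measurable_EFinP; apply: measurableT_comp => //; exact: normr_measurable.
rewrite integralE [in RHS]integralE.
have pp : past_measurable e t (U ^\+)%R by exact: measurable_funrpos.
have pn : past_measurable e t (U ^\-)%R by exact: measurable_funrneg.
have hp (D : set T) : (\int[P]_(x in D) ((EFin \o U) ^\+ x) = \int[P]_(x in D) ((U ^\+)%R x)%:E)%E.
  by apply: eq_integral => x _; rewrite funeposE /funrpos/= EFin_max.
have hn (D : set T) : (\int[P]_(x in D) ((EFin \o U) ^\- x) = \int[P]_(x in D) ((U ^\-)%R x)%:E)%E.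
  by apply: eq_integral => x _; rewrite funenegE /funrneg/= EFin_max EFinN.
rewrite !hp !hn !ge0_case//.
rewrite pE [RHS]muleBr// fin_num_adde_defr// -hp.
exact: integrable_pos_fin_num.
Qed.

End Past.

(** * Expectations and events of high probability *)

Section Expectation.
Context {R : realType} {d : measure_display} {T : measurableType d}.
Variable P : probability T R.
Implicit Types f g : T -> R.

Definition Ex (f : T -> R) : R := Rintegral P setT f.

Definition L1 (f : T -> R) := P.-integrable setT (EFin \o f).

Lemma L1_measurable f : L1 f -> measurable_fun setT f.
Proof. by move=> /measurable_int/measurable_EFinP. Qed.

Lemma L1D f g : L1 f -> L1 g -> L1 (fun x => f x + g x).
Proof. by move=> f1 g1; exact: (integrableD measurableT f1 g1). Qed.

Lemma L1Z a f : L1 f -> L1 (fun x => a * f x).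
Proof. by move=> f1; exact: (integrableZl measurableT a f1). Qed.

Lemma L1_sum I (s : seq I) (f : I -> T -> R) :
  (forall i, L1 (f i)) -> L1 (fun x => \sum_(i <- s) f i x).
Proof.
move=> f1; rewrite /L1 (_ : EFin \o _ = fun x => (\sum_(i <- s) (f i x)%:E)%E).
  by apply: integrable_sum => // i _; exact: f1.
by apply/funext => x /=; rewrite sumEFin.
Qed.

Lemma L1_le (f g : T -> R) : measurable_fun setT f -> L1 g ->
  (forall x, `|f x| <= g x) -> L1 f.
Proof.
move=> mf g1 fg; apply: le_integrable g1 => //; first exact/measurable_EFinP.
by move=> x _ /=; rewrite lee_fin (le_trans (fg x))// ler_norm.
Qed.

Lemma L1_cst a : L1 (fun=> a).
Proof. exact: finite_measure_integrable_cst. Qed.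

Lemma L1_bounded (f : T -> R) M : measurable_fun setT f -> (forall x, `|f x| <= M) -> L1 f.
Proof. by move=> mf fM; apply: (L1_le mf (L1_cst M)). Qed.

Lemma L1_mul (f g : T -> R) : measurable_fun setT f -> measurable_fun setT g ->
  L1 (fun x => f x ^+ 2) -> L1 (fun x => g x ^+ 2) -> L1 (fun x => f x * g x).
Proof.
move=> mf mg f2 g2; apply: L1_le (L1D f2 g2) _; first exact: measurable_funM.
move=> x; rewrite normrM; have := sqr_ge0 (`|f x| - `|g x|).
rewrite sqrrB !real_normK ?num_real//.
have := sqr_ge0 (f x); have := sqr_ge0 (g x).
have := mulr_ge0 (normr_ge0 (f x)) (normr_ge0 (g x)); lra.
Qed.

Lemma L1_ge0 (f : T -> R) : measurable_fun setT f -> (forall x, 0 <= f x) ->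
  ('E_P[f] < +oo)%E -> L1 f.
Proof.
move=> mf f0; rewrite unlock => foo; apply/integrableP; split.
  exact/measurable_EFinP.
rewrite (eq_integral (fun x => (f x)%:E))// => x _ /=.
by rewrite ger0_norm.
Qed.

Lemma Ex_fine f : fine 'E_P[f] = Ex f.
Proof. by rewrite unlock. Qed.

Lemma eq_Ex f g : f =1 g -> Ex f = Ex g.
Proof. by move=> /funext ->. Qed.

Lemma ExD f g : L1 f -> L1 g -> Ex (fun x => f x + g x) = Ex f + Ex g.
Proof. by move=> f1 g1; rewrite /Ex RintegralD. Qed.

Lemma ExZ a f : L1 f -> Ex (fun x => a * f x) = a * Ex f.
Proof. by move=> f1; rewrite /Ex RintegralZl. Qed.

Lemma Ex_sum I (s : seq I) (f : I -> T -> R) : (forall i, L1 (f i)) ->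
  Ex (fun x => \sum_(i <- s) f i x) = \sum_(i <- s) Ex (f i).
Proof.
move=> f1; elim: s => [|i s ih].
  rewrite big_nil /Ex; under eq_Rintegral do rewrite big_nil.
  by rewrite Rintegral_cst// mul0r.
rewrite big_cons -ih -ExD//; last exact: L1_sum.
by apply: eq_Ex => x; rewrite big_cons.
Qed.

Lemma Ex_le f g : L1 f -> L1 g -> (forall x, f x <= g x) -> Ex f <= Ex g.
Proof. by move=> f1 g1 fg; apply: le_Rintegral. Qed.

Lemma Ex_ge0 f : (forall x, 0 <= f x) -> 0 <= Ex f.
Proof. by move=> f0; apply: Rintegral_ge0. Qed.

Lemma Ex_cst a : Ex (fun=> a) = a.
Proof.
rewrite /Ex (_ : Rintegral _ _ _ = a * fine (P setT)); last exact: Rintegral_cst.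
by rewrite probability_setT mulr1.
Qed.

Lemma L1_indic A : measurable A -> L1 (\1_A : T -> R).
Proof. by move=> mA; apply: integrable_indic; rewrite // fin_num_measure. Qed.

Lemma Ex_indic A : measurable A -> Ex (\1_A) = fine (P A).
Proof. by move=> mA; rewrite -Ex_fine expectation_indic. Qed.

Lemma ae_eq_Ex f g : measurable_fun setT f -> measurable_fun setT g ->
  {ae P, forall x, f x = g x} -> Ex f = Ex g.
Proof.
move=> mf mg fg; rewrite /Ex /Rintegral; congr fine.
apply: ae_eq_integral => //; [exact/measurable_EFinP|exact/measurable_EFinP|].
by apply: filterS fg => x /= -> _.
Qed.

Lemma markov_Ex f (a : R) : L1 f -> (forall x, 0 <= f x) -> 0 < a ->
  (P [set x | a <= f x]%R <= (Ex f / a)%:E)%E.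
Proof.
move=> f1 f0 a0; have mf := L1_measurable f1.
have mA : measurable [set x | a <= f x].
  have := mf measurableT `[a, +oo[%classic (measurable_itv _); rewrite setTI.
  by congr measurable; apply/seteqP; split => x /=; rewrite in_itv/= andbT.
rewrite -[leLHS]fineK ?fin_num_measure// lee_fin ler_pdivlMr//.
rewrite -Ex_indic// mulrC -ExZ; last exact: L1_indic.
apply: Ex_le => //; first by apply: L1Z; exact: L1_indic.
move=> x; rewrite indicE; have [|_] := boolP (x \in _); last by rewrite mulr0.
by rewrite inE/= mulr1.
Qed.

(** Each new term adds its second moment and twice its covariances with the earlier ones, which
    depend on the lag only through [c]. Used with [c = 0] for innovation terms and with the mixing
    coefficients for indicators. *)
Lemma Ex_sqr_sum_le (Z : nat -> T -> R) (c : nat -> R) (B C : R) k :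
  (forall i j, L1 (fun x => Z i x * Z j x)) ->
  (forall i, Ex (fun x => Z i x * Z i x) <= B) ->
  (forall i j, (i < j)%N -> Ex (fun x => Z i x * Z j x) <= c (j - i)%N) ->
  (forall n, \sum_(i < n) c i.+1 <= C) ->
  Ex (fun x => (\sum_(i < k) Z i x) ^+ 2) <= k%:R * (B + 2 * C).
Proof.
move=> Z1 ZB Zc cC; elim: k => [|k ih].
  rewrite mul0r (eq_Ex (g := fun=> 0)) ?Ex_cst// => x.
  by rewrite big_ord0 expr0n.
rewrite (eq_Ex (g := fun x => (\sum_(i < k) Z i x) ^+ 2 +
    (2 * (\sum_(i < k) (Z i x * Z k x)) + Z k x * Z k x))); last first.
  move=> x; rewrite big_ord_recr/= -mulr_suml; ring.
have L2 n : L1 (fun x => (\sum_(i < n) Z i x) ^+ 2).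
  rewrite (_ : (fun x => _) = fun x => \sum_(i < n) \sum_(j < n) Z i x * Z j x).
    by apply: L1_sum => i; apply: L1_sum => j; exact: Z1.
  apply/funext => x; rewrite expr2 big_distrl/=; apply: eq_bigr => i _.
  by rewrite big_distrr.
have L3 : L1 (fun x => \sum_(i < k) Z i x * Z k x) by exact: L1_sum.
rewrite ExD//; last by apply: L1D => //; exact: L1Z.
rewrite ExD//; last exact: L1Z.
rewrite ExZ// Ex_sum//.
have h : \sum_(i < k) Ex (fun x => Z i x * Z k x) <= C.
  apply: le_trans (cC k).
  (* Reversal turns the lags [k - i] into [i + 1], the order in which [c] is summed. *)
  rewrite (reindex_inj rev_ord_inj)/=; apply: ler_sum => i _.
  apply: le_trans (Zc _ _ _) _ => /=; first by rewrite ltn_subrL/=; case: k i {ih L2 L3} => // -[].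
  by rewrite subKn.
rewrite -natr1 mulrDl mul1r; have := ZB k; lra.
Qed.

(* [E] itself is not required to be measurable. *)
Definition whp (eps : R) (E : T -> Prop) := exists N : set T,
  [/\ measurable N, (P N <= eps%:E)%E & forall x, ~ N x -> E x].

Lemma whp_le (eps eps' : R) E : eps <= eps' -> whp eps E -> whp eps' E.
Proof.
move=> ee [N [mN PN NE]]; exists N; split => //.
by apply: le_trans PN _; rewrite lee_fin.
Qed.

Lemma whpS eps (E F : T -> Prop) : (forall x, E x -> F x) -> whp eps E -> whp eps F.
Proof. by move=> EF [N [mN PN NE]]; exists N; split => // x /NE/EF. Qed.

Lemma whp_and eps1 eps2 E F : whp eps1 E -> whp eps2 F ->
  whp (eps1 + eps2) (fun x => E x /\ F x).
Proof.
move=> [N [mN PN NE]] [M [mM PM MF]]; exists (N `|` M); split.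
- exact: measurableU.
- rewrite EFinD; apply: le_trans (leeD PN PM); exact: measureU2.
- by move=> x /not_orP[/NE ? /MF].
Qed.

Lemma whp_ae E : {ae P, forall x, E x} -> whp 0 E.
Proof.
move=> [N [mN PN NE]]; exists N; split => //; first by rewrite PN.
by move=> x Nx; apply: contrapT => /NE.
Qed.

Lemma whp_forall_seq (I : eqType) (s : seq I) eps (E : I -> T -> Prop) :
  (forall i, whp eps (E i)) ->
  whp ((size s)%:R * eps) (fun x => forall i, i \in s -> E i x).
Proof.
move=> h; elim: s => [|i s ih].
  by exists set0; rewrite measure0 mul0r; split.
rewrite /= -natr1 mulrDl mul1r addrC.
apply: whpS (whp_and (h i) ih) => x [Ei Es] j.
by rewrite inE => /predU1P[->|/Es].
Qed.

Lemma whp_forall (I : finType) eps (E : I -> T -> Prop) :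
  (forall i, whp eps (E i)) -> whp (#|I|%:R * eps) (fun x => forall i, E i x).
Proof.
move=> h; rewrite cardE; apply: whpS (whp_forall_seq (enum I) h) => x Ex i.
by apply: Ex; rewrite mem_enum.
Qed.

Lemma prob_le_whp eps E A : measurable A -> whp eps E ->
  (forall x, E x -> ~ A x) -> (P A <= eps%:E)%E.
Proof.
move=> mA [N [mN PN NE]] EA; apply: le_trans PN; apply: le_measure; rewrite ?inE//.
by move=> x Ax; apply: contrapT => /NE/EA.
Qed.

Lemma whp_markov f (B a : R) : L1 f -> (forall x, 0 <= f x) -> 0 < a -> Ex f <= B ->
  whp (B / a) (fun x => f x < a).
Proof.
move=> f1 f0 a0 fB; exists [set x | a <= f x]; split.
- have := L1_measurable f1 measurableT (measurable_itv `[a, +oo[); rewrite setTI.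
  by congr measurable; apply/seteqP; split => x /=; rewrite in_itv/= andbT.
- apply: le_trans (markov_Ex f1 f0 a0) _; rewrite lee_fin.
  by rewrite ler_pM2r ?invr_gt0.
- by move=> x /negP; rewrite -ltNge.
Qed.

Lemma whp_sum (Z : nat -> T -> R) (c : nat -> R) (B C a : R) k :
  (forall i j, L1 (fun x => Z i x * Z j x)) ->
  (forall i, Ex (fun x => Z i x * Z i x) <= B) ->
  (forall i j, (i < j)%N -> Ex (fun x => Z i x * Z j x) <= c (j - i)%N) ->
  (forall n, \sum_(i < n) c i.+1 <= C) -> 0 < a ->
  whp (k%:R * (B + 2 * C) / a ^+ 2) (fun x => `|\sum_(i < k) Z i x| < a).
Proof.
move=> Z1 ZB Zc cC a0.
have S1 : L1 (fun x => (\sum_(i < k) Z i x) ^+ 2).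
  rewrite (_ : (fun x => _) = fun x => \sum_(i < k) \sum_(j < k) Z i x * Z j x).
    by apply: L1_sum => i; apply: L1_sum => j; exact: Z1.
  apply/funext => x; rewrite expr2 big_distrl/=; apply: eq_bigr => i _.
  by rewrite big_distrr.
apply: whpS (whp_markov S1 _ _ (Ex_sqr_sum_le k Z1 ZB Zc cC)).
- by move=> x; rewrite -real_normK ?num_real// ltr_pXn2r ?nnegrE// ltW.
- by move=> x; exact: sqr_ge0.
- by rewrite exprn_gt0.
Qed.

End Expectation.

(** * The autoregressive process *)

Section Autoregression.
Context {R : realType} {d : measure_display} {T : measurableType d}.
Variable P : probability T R.
Variable p : nat.
Variables (e y : int -> {RV P >-> R}).

Lemma measurable_lags (z : int -> T -> R) t :
  (forall s, measurable_fun [set: T] (z s)) ->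
  measurable_fun [set: T] (lags p z t : T -> borel_cV R p).
Proof.
move=> mz; apply: measurable_borel_cV => i.
by under eq_fun do rewrite mxE; exact: mz.
Qed.

Lemma eq_law_lags (A : set (borel_cV R p)) t : strictly_stationary y ->
  measurable A -> P (lags p y t @^-1` A) = P (lags p y 0 @^-1` A).
Proof.
move=> ystat; apply: eq_law_boxes.
- by apply: measurable_lags => s; exact: (measurable_funPT (y s)).
- by apply: measurable_lags => s; exact: (measurable_funPT (y s)).
move=> _ [B [mB ->]].
(* Stationarity takes a family over all times: coordinate [i] sits at time [- i], recovered through
   the absolute value, and times that carry no coordinate get [setT]. *)
pose B' (s : int) := if insub `|s|%N is Some i then B i else setT.
have mB' s : measurable (B' s) by rewrite /B'; case: insub.
have E (h : int) : lags p y h @^-1` [set x : 'cV[R]_p | forall i, B i (x i 0)] =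
    \big[setI/setT]_(s <- [seq - (val i)%:Z | i <- enum 'I_p])
      (y (s + h) @^-1` B' s).
  apply/seteqP; split => om.
    move=> h1; apply/bigsetI_seqP => _ /mapP[i _ ->].
    rewrite /B' /preimage/= abszN absz_nat valK.
    by have := h1 i; rewrite mxE addrC.
  move=> /bigsetI_seqP h1 i /=; rewrite mxE.
  have /h1 : - (val i)%:Z \in [seq - (val i)%:Z | i <- enum 'I_p].
    by apply: (map_f (fun i : 'I_p => - (val i)%:Z)); rewrite mem_enum.
  by rewrite /B' /preimage/= abszN absz_nat valK addrC.
rewrite !E (ystat t _ _ mB').
have -> : \big[setI/setT]_(s <- [seq - (val i)%:Z | i <- enum 'I_p]) (y s @^-1` B' s) =
  \big[setI/setT]_(s <- [seq - (val i)%:Z | i <- enum 'I_p]) (y (s + 0) @^-1` B' s).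
  by apply: eq_bigr => s _; rewrite addr0.
by [].
Qed.

(* The upper limit of the partial sums of the moving-average representation
   agrees with [y s] almost surely and depends on the innovations up to time
   [s] only. *)
Lemma causal_past_version : causal e y -> exists y' : int -> T -> R,
  (forall s t, s < t -> past_measurable e t (y' s)) /\
  (forall s, {ae P, forall om, y s om = y' s om}).
Proof.
move=> [psi [_ ypsi]].
pose S s n om := series (fun j : nat => psi j * e (s - j%:Z) om) n.
pose y' s om := fine (limn_esup (fun n => (S s n om)%:E)).
exists y'; split.
  move=> s t st; apply: (measurableT_comp (fine_measurable measurableT)).
  apply: measurable_fun_limn_esup => n; apply/measurable_EFinP.
  apply: measurable_sum => j; apply: measurable_funM => //.
  by apply: past_measurable_e; apply: le_lt_trans st; rewrite gerBl.
move=> s; apply: filterS (ypsi s) => om cv.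
have : (fun n => (S s n om)%:E) @ \oo --> (y s om)%:E.
  by apply/fine_cvgP; split; [exact: nearW|exact: cv].
move=> /cvg_esups cv'; rewrite /y' limn_esup_lim.
by have /cvg_lim -> := cv'.
Qed.

Hypothesis e_indep : mutually_independent e.

(** The process is a function of past innovations only almost surely, so independence is applied to
    the version [U'] and carried back to [U]. *)
Lemma Ex_past_indic t (U U' : T -> R) (C : set R) : measurable C ->
  L1 P U -> past_measurable e t U' -> {ae P, forall om, U om = U' om} ->
  Ex P (fun om => U om * \1_C (e t om)) = fine (P (e t @^-1` C)) * Ex P U.
Proof.
move=> mC U1 pU' UU'.
have mU := L1_measurable U1; have mU' := past_measurable_measurable pU'.
have mE : measurable (e t @^-1` C).
  by rewrite -[X in measurable X]setTI; exact: (measurable_funPT (e t)).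
have mI : measurable_fun setT (fun om => \1_C (e t om) : R).
  by apply: measurableT_comp => //; exact: measurable_indic.
have U1' : L1 P U'.
  apply/integrableP; split; first exact/measurable_EFinP.
  have /integrableP[_] := U1; congr (_ < _)%E; apply: ae_eq_integral => //.
  - by apply/measurable_EFinP; exact: measurableT_comp.
  - by apply/measurable_EFinP; exact: measurableT_comp.
  - by apply: filterS UU' => om /= -> _.
rewrite (ae_eq_Ex mU mU' UU').
rewrite (@ae_eq_Ex _ _ _ _ _ (fun om => U' om * \1_C (e t om))); last 3 first.
- exact: measurable_funM.
- exact: measurable_funM.
- by apply: filterS UU' => om ->.
transitivity (fine (\int[P]_(x in e t @^-1` C) (U' x)%:E)).
  rewrite integral_mkcond; congr fine; apply: eq_integral => om _.
  rewrite patchE indicE -[om \in _]/(e t om \in C).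
  by case: (_ \in _); rewrite ?mulr1 ?mulr0.
rewrite integral_past_indic// fineM// ?fin_num_measure//.
exact: integrable_fin_num.
Qed.

Lemma past_measurable_lags (y' : int -> T -> R) (t : int) :
  (forall s, s < t -> past_measurable e t (y' s)) ->
  forall s, s < t -> forall b : borel_cV R p -> R, measurable_fun setT b ->
  past_measurable e t (fun om => b (lags p y' s om)).
Proof.
move=> py' s st b mb; apply: (measurableT_comp mb).
apply: measurable_borel_cV => i.
rewrite (_ : (fun om => _) = y' (s - i%:Z)).
  by apply: py'; apply: le_lt_trans st; rewrite gerBl.
by apply/funext => om; rewrite /lags mxE.
Qed.

Hypotheses (e_ident : identically_distributed e) (y_causal : causal e y).

Variables (C : set R) (b : borel_cV R p -> R).
Hypotheses (mC : measurable C) (mb : measurable_fun setT b).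
Hypothesis b2 : forall t, L1 P (fun om => b (lags p y t om) ^+ 2).

Let pC := fine (P (e 0 @^-1` C)).

(** A martingale difference. The score takes [C] the half-line up to 0 and [b] a coordinate of
    [astar]; the drift takes [C] a short interval beside 0 and [b] the indicator of a set of
    regressors. *)
Definition innovation_term (t : int) (om : T) : R :=
  (\1_C (e t om) - pC) * b (lags p y (t - 1) om).

Let pC01 : 0 <= pC <= 1.
Proof.
have mE : measurable (e 0 @^-1` C).
  by rewrite -[X in measurable X]setTI; exact: (measurable_funPT (e 0)).
rewrite /pC fine_ge0//= -lee_fin fineK ?fin_num_measure//.
exact: probability_le1.
Qed.

Let mbX t : measurable_fun setT (fun om => b (lags p y t om)).
Proof.
apply: (measurableT_comp mb); apply: measurable_lags => s.
exact: (measurable_funPT (y s)).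
Qed.

Let mI t : measurable_fun setT (fun om => \1_C (e t om) : R).
Proof. by apply: measurableT_comp => //; exact: measurable_indic. Qed.

Let eta_le1 t om : `|\1_C (e t om) - pC| <= 1.
Proof. by rewrite indicE ler_norml; case: (_ \in _) => /=; case/andP: pC01; lra. Qed.

Lemma measurable_innovation_term t : measurable_fun setT (innovation_term t).
Proof. by apply: measurable_funM => //; exact: measurable_funB. Qed.

Let innovation_term_sqr_le t om :
  innovation_term t om ^+ 2 <= b (lags p y (t - 1) om) ^+ 2.
Proof.
rewrite exprMn ler_piMl ?sqr_ge0//.
by rewrite -real_normK ?num_real// expr_le1.
Qed.

Lemma L1_innovation_term s t :
  L1 P (fun om => innovation_term s om * innovation_term t om).
Proof.
have h u : L1 P (fun om => innovation_term u om ^+ 2).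
  apply: L1_le (b2 (u - 1)) _.
    by apply: measurable_funX; exact: measurable_innovation_term.
  by move=> om; rewrite ger0_norm ?sqr_ge0.
by apply: L1_mul => //; exact: measurable_innovation_term.
Qed.

Let p_e t : fine (P (e t @^-1` C)) = pC.
Proof. by rewrite /pC (e_ident t 0). Qed.

(** Apart from the centred indicator of [e t], every factor is determined by innovations before [t],
    so the expectation factors through a mean of zero. *)
Lemma innovation_term_orth s t : s < t ->
  Ex P (fun om => innovation_term s om * innovation_term t om) = 0.
Proof.
move=> st.
have [y' [py' yy']] := causal_past_version y_causal.
pose U om := (\1_C (e s om) - pC) * (b (lags p y (s - 1) om) * b (lags p y (t - 1) om)).
pose U' om := (\1_C (e s om) - pC) * (b (lags p y' (s - 1) om) * b (lags p y' (t - 1) om)).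
have lags_ae u : {ae P, forall om, lags p y u om = lags p y' u om}.
  have : {ae P, forall om, forall n : nat, y (u - n%:Z) om = y' (u - n%:Z) om}.
    by apply: ae_foralln => n; exact: yy'.
  by apply: filterS => om h; apply/colP => i; rewrite !mxE.
have UU' : {ae P, forall om, U om = U' om}.
  apply: filterS2 (lags_ae (s - 1)) (lags_ae (t - 1)) => om h1 h2.
  by rewrite /U /U' h1 h2.
have t1 : t - 1 < t by rewrite gtrBl.
have pU' : past_measurable e t U'.
  apply: measurable_funM.
    apply: measurable_funB => //.
    have mIC : measurable_fun setT (\1_C : R -> R) by exact: measurable_indic.
    have pes : past_measurable e t (e s) by exact: past_measurable_e.
    exact: (measurableT_comp mIC pes).
  apply: measurable_funM; apply: past_measurable_lags => //.
  - by move=> u; exact: py'.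
  - by apply: lt_trans st; rewrite gtrBl.
  - by move=> u; exact: py'.
have U1 : L1 P U.
  have bb : L1 P (fun om => b (lags p y (s - 1) om) * b (lags p y (t - 1) om)) by exact: L1_mul.
  have nbb : L1 P (fun om => `|b (lags p y (s - 1) om) * b (lags p y (t - 1) om)|).
    exact: (integrable_abse bb).
  apply: L1_le nbb _.
    apply: measurable_funM; first exact: measurable_funB.
    exact: measurable_funM.
  by move=> om; rewrite normrM ler_piMl.
have UI : L1 P (fun om => U om * \1_C (e t om)).
  apply: L1_le (integrable_abse U1 : L1 P (fun om => `|U om|)) _.
    by apply: measurable_funM => //; exact: L1_measurable U1.
  move=> om; rewrite normrM ler_piMr// indicE; case: (_ \in _); by rewrite ?normr1 ?normr0.
rewrite (@eq_Ex _ _ _ P _ (fun om => U om * \1_C (e t om) + (- pC) * U om)); last first.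
  by move=> om; rewrite /innovation_term /U; ring.
rewrite ExD//; last exact: L1Z.
rewrite ExZ// (Ex_past_indic mC U1 pU' UU') p_e; ring.
Qed.

(** The centred indicator has variance [pC (1 - pC) <= pC]. Keeping the factor [pC] matters for the
    drift, where [pC] is of order [rho] and Chebyshev then fails with probability of order
    [1 / (k rho)]. *)
Lemma innovation_term_sqr t :
  Ex P (fun om => innovation_term t om * innovation_term t om) <=
  pC * Ex P (fun om => b (lags p y (t - 1) om) ^+ 2).
Proof.
have [y' [py' yy']] := causal_past_version y_causal.
pose U om := b (lags p y (t - 1) om) ^+ 2.
pose U' om := b (lags p y' (t - 1) om) ^+ 2.
have U1 : L1 P U := b2 (t - 1).
have UU' : {ae P, forall om, U om = U' om}.
  have : {ae P, forall om, forall n : nat, y (t - 1 - n%:Z) om = y' (t - 1 - n%:Z) om}.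
    by apply: ae_foralln => n; exact: yy'.
  apply: filterS => om h; rewrite /U /U'; congr (b _ ^+ 2).
  by apply/colP => i; rewrite !mxE.
have t1 : t - 1 < t by rewrite gtrBl.
have pU' : past_measurable e t U'.
  apply: measurable_funX; apply: past_measurable_lags => // u; exact: py'.
have UI : L1 P (fun om => U om * \1_C (e t om)).
  apply: (L1_le _ U1).
    by apply: measurable_funM => //; exact: L1_measurable U1.
  move=> om; rewrite normrM ger0_norm ?sqr_ge0// ler_piMr ?sqr_ge0// indicE.
  by case: (_ \in _); rewrite ?normr1 ?normr0.
rewrite (@eq_Ex _ _ _ P _ (fun om => (1 - 2 * pC) * (U om * \1_C (e t om)) + pC ^+ 2 * U om)); last first.
  move=> om; rewrite /innovation_term /U indicE; case: (_ \in _) => /=; ring.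
rewrite ExD//; [|exact: L1Z|exact: L1Z].
rewrite !ExZ// (Ex_past_indic mC U1 pU' UU') p_e -/U.
have U0 : 0 <= Ex P U by apply: Ex_ge0 => om; exact: sqr_ge0.
have := mulr_ge0 (sqr_ge0 pC) U0; lra.
Qed.

Lemma whp_innovation_sum (a0 : nat) (k : nat) (a B : R) : 0 < a ->
  (forall t, Ex P (fun om => b (lags p y t om) ^+ 2) <= B) ->
  whp P (k%:R * (pC * B) / a ^+ 2)
    (fun om => `|\sum_(i < k) innovation_term (a0 + i).+1%:Z om| < a).
Proof.
move=> a_gt0 bB.
have := @whp_sum _ _ _ P (fun i => innovation_term (a0 + i).+1%:Z) (fun=> 0) (pC * B) 0 a k.
rewrite mulr0 addr0; apply => //.
- by move=> i j; exact: L1_innovation_term.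
- move=> i; apply: le_trans (innovation_term_sqr _) _.
  by rewrite ler_wpM2l//; case/andP: pC01.
- move=> i j ij; rewrite innovation_term_orth// ltz_nat ltnS ltn_add2l//.
- by move=> n; rewrite big1.
Qed.

End Autoregression.

(** * Mixing *)

Section Mixing.
Context {R : realType} {d : measure_display} {T : measurableType d}.
Variable P : probability T R.
Variables (m : nat) (v : int -> T -> 'cV[R]_m).
Hypothesis mv : forall t, measurable_fun [set: T] (v t : T -> borel_cV R m).

Lemma sigma_generated_measurable I A : sigma_generated v I A -> measurable A.
Proof.
apply: smallest_sub; first exact: sigma_algebra_measurable.
by move=> _ [s _ [B mB <-]]; exact: mv.
Qed.

Let sigma_generated0 I : sigma_generated v I set0.
Proof. by case: (@smallest_sigma_algebra T setT (\bigcup_(s in I)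
  preimage_set_system setT (v s) (@measurable _ (borel_cV R m)))). Qed.

Let fineP01 A : measurable A -> 0 <= fine (P A) <= 1.
Proof.
move=> mA; rewrite fine_ge0//= -lee_fin fineK ?fin_num_measure//.
exact: probability_le1.
Qed.

Let alpha_set_le1 A B : measurable A -> measurable B ->
  `|fine (P (A `&` B)) - fine (P A) * fine (P B)| <= 1.
Proof.
move=> mA mB; have /andP[a0 a1] := fineP01 mA; have /andP[b0 b1] := fineP01 mB.
have /andP[c0 c1] := fineP01 (measurableI _ _ mA mB).
rewrite ler_norml; apply/andP; split.
  have := mulr_ile1 a0 b0 a1 b1; lra.
by have := mulr_ge0 a0 b0; lra.
Qed.

Lemma le_alpha_mixing t l A B :
  sigma_generated v [set s | s <= t] A ->
  sigma_generated v [set s | t + l%:Z <= s] B ->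
  `|fine (P (A `&` B)) - fine (P A) * fine (P B)| <= alpha_mixing P v l.
Proof.
move=> sA sB; apply: ub_le_sup; last by exists t, A, B.
exists 1 => _ [s [A' [B' [/sigma_generated_measurable mA /sigma_generated_measurable mB ->]]]].
exact: alpha_set_le1.
Qed.

Lemma alpha_mixing_ge0 l : 0 <= alpha_mixing P v l.
Proof.
by apply: le_trans (@le_alpha_mixing 0 l set0 set0 _ _); first exact: normr_ge0.
Qed.

Lemma alpha_mixing_le1 l : alpha_mixing P v l <= 1.
Proof.
apply: ge_sup.
  exists `|fine (P (set0 `&` set0)) - fine (P set0) * fine (P set0)|.
  by exists 0, set0, set0; split.
move=> _ [s [A' [B' [/sigma_generated_measurable mA /sigma_generated_measurable mB ->]]]].
exact: alpha_set_le1.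
Qed.

(** The coefficients lie in [0, 1] and [c <= 1], so each is at most its [c]-th power; covariances of
    indicators need only this plain summability. *)
Lemma summable_alpha_mixing (c : R) : 0 < c <= 1 ->
  (\sum_(1 <= l <oo) (alpha_mixing P v l `^ c)%:E < +oo)%E ->
  exists C : R, forall n, \sum_(i < n) alpha_mixing P v i.+1 <= C.
Proof.
move=> /andP[c0 c1] fin; set S := (\sum_(1 <= l <oo) _)%E in fin.
have S0 : (0 <= S)%E by apply: nneseries_ge0 => n _ _; rewrite lee_fin powR_ge0.
exists (fine S) => n.
have Sfin : S \is a fin_num by rewrite ge0_fin_numE.
rewrite -lee_fin fineK//.
apply: le_trans (nneseries_lim_ge n.+1 _); last by move=> l _ _; rewrite lee_fin powR_ge0.
rewrite big_add1/= big_mkord -sumEFin; apply: lee_sum => i _; rewrite lee_fin.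
have [->|a0] := eqVneq (alpha_mixing P v i.+1) 0; first by rewrite powR_ge0.
have a0' : 0 < alpha_mixing P v i.+1 by rewrite lt_def a0 alpha_mixing_ge0.
by apply: ger1_powR; rewrite // a0'/= alpha_mixing_le1.
Qed.

Lemma whp_mixing_sum (C : R) (A : set (borel_cV R m)) (a0 k : nat) (a : R) :
  (forall n, \sum_(i < n) alpha_mixing P v i.+1 <= C) -> measurable A -> 0 < a ->
  whp P (k%:R * (1 + 2 * C) / a ^+ 2)
   (fun om => `|\sum_(i < k) (\1_A (v (a0 + i).+1%:Z om) -
                  fine (P (v (a0 + i).+1%:Z @^-1` A)))| < a).
Proof.
move=> sumC mA a_gt0.
pose V i := v (a0 + i).+1%:Z @^-1` A.
have mV i : measurable (V i) by rewrite -[X in measurable X]setTI; exact: mv.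
pose Z i om := \1_(V i) om - fine (P (V i)) : R.
have mI i : measurable_fun setT (\1_(V i) : T -> R) by exact: measurable_indic.
have mZ i : measurable_fun setT (Z i) by exact: measurable_funB.
have I01 i om : 0 <= (\1_(V i) om : R) <= 1 by rewrite indicE; case: (_ \in _); rewrite /= ?lexx ?ler01.
have Z1 i om : `|Z i om| <= 1.
  rewrite ler_norml /Z; have /andP[] := fineP01 (mV i); have /andP[] := I01 i om; lra.
have ZZ i j : L1 P (fun om => Z i om * Z j om).
  apply: (@L1_bounded _ _ _ _ _ 1); first exact: measurable_funM.
  by move=> om; rewrite normrM mulr_ile1.
have ExZZ i j : Ex P (fun om => Z i om * Z j om) =
    fine (P (V i `&` V j)) - fine (P (V i)) * fine (P (V j)).
  rewrite (@eq_Ex _ _ _ P _ (fun om => \1_(V i `&` V j) om +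
      ((- fine (P (V j))) * \1_(V i) om + ((- fine (P (V i))) * \1_(V j) om +
       fine (P (V i)) * fine (P (V j)))))); last first.
    by move=> om; rewrite indicI /Z /=; ring.
  have LI i' : L1 P (\1_(V i') : T -> R) by exact: L1_indic.
  rewrite !ExD ?ExZ ?Ex_cst ?Ex_indic//.
  - ring.
  - exact: measurableI.
  1-7: by do ?[exact: L1_cst|exact: LI|exact/L1_indic/measurableI|exact: L1Z|apply: L1D].
have := @whp_sum _ _ _ P Z (alpha_mixing P v) 1 C a k ZZ; apply => //.
- move=> i; apply: le_trans (_ : Ex P (fun=> 1) <= 1); last by rewrite Ex_cst.
  apply: Ex_le => //; first exact: L1_cst.
  by move=> om; rewrite (le_trans (ler_norm _))// normrM mulr_ile1.
- move=> i j ij; rewrite ExZZ (le_trans (ler_norm _))//.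
  (* [V i] belongs to the past up to its own time and [V j] to the future at lag [j - i]; their
     covariance is the quantity that defines the coefficient. *)
  apply: (@le_alpha_mixing (a0 + i).+1%:Z).
    by apply: sub_sigma_algebra; exists (a0 + i).+1%:Z => /=; [exact: lexx|exists A; rewrite ?setTI].
  apply: sub_sigma_algebra; exists (a0 + j).+1%:Z => /=; last by exists A; rewrite ?setTI.
  by rewrite -PoszD lez_nat addSn ltnS -addnA leq_add2l subnKC// ltnW.
Qed.

End Mixing.

(** * Uniform lower bound for a positive definite form *)

Section PosDef.
Context {R : realType}.

(** No eigenvalues: if [u'M^-1 u <= C |u|^2], nonnegativity of the form at [u - C^-1 M^-1 u] reads
    [u'Mu - 2 C^-1 |u|^2 + C^-2 u'M^-1 u >= 0] and gives the bound with [C^-1]. *)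
Lemma posdef_lower_bound m (M : 'M[R]_m) : posdef M ->
  exists2 lam : R, 0 < lam &
    forall u : 'cV[R]_m, lam * norm2 u ^+ 2 <= (u^T *m M *m u) 0 0.
Proof.
move=> [Msym Mpos].
have Mge (u : 'cV[R]_m) : 0 <= (u^T *m M *m u) 0 0.
  have [->|/Mpos u0] := eqVneq u 0; first by rewrite mulmx0 mxE.
  exact: ltW.
have Munit : M \in unitmx.
  rewrite unitmxE unitfE; apply/det0P => -[x x0 xM].
  have /Mpos : x^T != 0 by apply: contra x0 => /eqP h; rewrite -(trmxK x) h linear0.
  by rewrite trmxK xM mul0mx mxE ltxx.
pose C := 1 + \sum_i \sum_j `|invmx M i j|.
have C1 : 1 <= C by rewrite lerDl; do 2![apply: sumr_ge0 => ? _].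
have C0 : 0 < C by exact: lt_le_trans C1.
exists C^-1; first by rewrite invr_gt0.
move=> u; pose x := invmx M *m u.
have Mx : M *m x = u by rewrite /x mulmxA mulmxV// mul1mx.
have xMx : dotp u x <= C * norm2 u ^+ 2.
  rewrite (le_trans (ler_norm _))// (le_trans (CauchySchwarz_dotp _ _))//.
  rewrite expr2 mulrA mulrC ler_wpM2r ?norm2_ge0//.
  apply: le_trans (norm2_le_sum _) _; rewrite mulrDl mul1r.
  apply: le_trans (_ : \sum_i \sum_j `|invmx M i j| * norm2 u <= _); last first.
    under eq_bigr do rewrite -mulr_suml.
    by rewrite -mulr_suml lerDr norm2_ge0.
  apply: ler_sum => i _; rewrite mxE; apply: le_trans (ler_norm_sum _ _ _) _.
  apply: ler_sum => j _; rewrite normrM ler_wpM2l//; exact: ler_coord_norm2.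
have := Mge (u - C^-1 *: x).
have -> : ((u - C^-1 *: x)^T *m M *m (u - C^-1 *: x)) 0 0 =
    (u^T *m M *m u) 0 0 - 2 * C^-1 * dotp u u + C^-1 ^+ 2 * dotp u x.
  rewrite -mulmxA mulmxBr -scalemxAr Mx.
  rewrite -/(dotp (u - C^-1 *: x) (M *m u - C^-1 *: u)).
  rewrite dotpBl !dotpBr !dotpZl !dotpZr.
  have -> : dotp x (M *m u) = dotp u u.
    by rewrite /dotp mulmxA -{1}Msym -trmx_mul Mx.
  rewrite (dotpC x u) /dotp mulmxA; ring.
rewrite -sqr_norm2 => h.
have : C^-1 ^+ 2 * dotp u x <= C^-1 * norm2 u ^+ 2.
  apply: le_trans (ler_wpM2l (sqr_ge0 _) xMx) _.
  by rewrite expr2 mulrA -[C^-1 * C^-1 * C]mulrA mulVf ?gt_eqF// mulr1.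
lra.
Qed.

End PosDef.

(** * Moments and frequencies along the process *)

Section Grid.
Context {R : realType}.

Definition grid_point m N (f : {ffun 'I_m -> 'I_(N.*2.+1)}) : 'cV[R]_m :=
  \col_i ((f i)%:R / N%:R - 1).

Lemma grid_approx m N (u : 'cV[R]_m) : (0 < N)%N -> (forall i, `|u i 0| <= 1) ->
  exists f : {ffun 'I_m -> 'I_(N.*2.+1)},
    forall i, `|u i 0 - grid_point f i 0| <= N%:R^-1.
Proof.
move=> N0 u1.
have NR : 0 < N%:R :> R by rewrite ltr0n.
have key (x : R) : `|x| <= 1 ->
    exists j : 'I_(N.*2.+1), `|x - (j%:R / N%:R - 1)| <= N%:R^-1.
  rewrite ler_norml => /andP[x1 x2].
  have z0 : 0 <= (x + 1) * N%:R by rewrite mulr_ge0 ?(ltW NR)//; lra.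
  have /andP[t1 t2] := truncn_itv z0.
  have jN : (Num.truncn ((x + 1) * N%:R)%R < N.*2.+1)%N.
    rewrite ltnS -(ler_nat R) (le_trans t1)// -mul2n natrM.
    by rewrite ler_pM2r//; lra.
  exists (Ordinal jN) => /=.
  set j := Num.truncn _ in t1 t2 *.
  have -> : x - (j%:R / N%:R - 1) = ((x + 1) * N%:R - j%:R) / N%:R.
    by field; rewrite gt_eqF.
  rewrite normrM ger0_norm ?subr_ge0// normfV gtr0_norm//.
  rewrite ler_piMl ?invr_ge0 ?ltW//.
  by move: t2; rewrite -natr1; lra.
exists [ffun i => sval (cid (key _ (u1 i)))] => i.
by rewrite mxE ffunE; case: cid.
Qed.

(** The inner product of [v] with the unit vector [u] is at least [1 - m h]. Grid neighbours of unit
    vectors are not unit vectors, which is why later estimates assume norm at least 1/2. *)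
Lemma norm2_grid_ge m (u v : 'cV[R]_m) (h : R) : norm2 u = 1 ->
  (forall i, `|u i 0 - v i 0| <= h) -> m%:R * h <= 2^-1 -> 2^-1 <= norm2 v.
Proof.
move=> u1 uv mh.
have uu : dotp u u = 1 by rewrite -sqr_norm2 u1 expr1n.
have := CauchySchwarz_dotp v u; rewrite u1 mulr1 => /(le_trans (ler_norm _)).
have := dist_dotp_le u uv.
have s1 : \sum_i `|u i 0| <= m%:R.
  have -> : m%:R = \sum_(i < m) (1 : R) by rewrite sumr_const card_ord.
  by apply: ler_sum => i _; rewrite (le_trans (ler_coord_norm2 _ _))// u1.
have [h0|h0] := leP 0 h; last first.
  case: m u v u1 uv mh uu s1 => [|m] u v u1 uv mh uu s1.
    by move: uu; rewrite dotpE big_ord0 => /eqP; rewrite eq_sym oner_eq0.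
  by have := le_lt_trans (uv 0) h0; rewrite normr_lt0.
have := ler_wpM2l h0 s1.
rewrite uu ler_norml => h1 /andP[_ h2]; lra.
Qed.

End Grid.

Section Moments.
Context {R : realType} {d : measure_display} {T : measurableType d}.
Variable P : probability T R.
Variables (p q : nat) (y : int -> {RV P >-> R}).
Variables (w : 'cV[R]_p -> R) (phi : 'cV[R]_p -> 'cV[R]_q) (beta0 : 'cV[R]_p).
Hypothesis w_meas : measurable_fun [set: borel_cV R p] (w : borel_cV R p -> R).
Hypothesis phi_meas : measurable_fun [set: borel_cV R p]
  (phi : borel_cV R p -> borel_cV R q).
Hypothesis ystat : strictly_stationary y.

Local Notation X t := (lags p y (t - 1)).
Local Notation astarX t om := (astar w phi (X t om)).

Lemma measurable_astar :
  measurable_fun [set: borel_cV R p] (astar w phi : borel_cV R p -> borel_cV R (p + q)).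
Proof.
apply: measurable_borel_cV => i.
rewrite (_ : (fun x => _) = fun x => w x * (avec phi x) i 0); last first.
  by apply/funext => x; rewrite mxE.
apply: measurable_funM => //.
have [j jE|j jE] := split_ordP i.
  rewrite (_ : (fun x => _) = fun x : borel_cV R p => (x : 'cV[R]_p) j 0).
    exact: measurable_coord.
  by apply/funext => x; rewrite /avec jE col_mxEu.
rewrite (_ : (fun x => _) = fun x : borel_cV R p => phi x j 0).
  exact: measurable_cV_coord.
by apply/funext => x; rewrite /avec jE col_mxEd.
Qed.

Lemma measurable_X t : measurable_fun [set: T] (X t : T -> borel_cV R p).
Proof. by apply: measurable_lags => s; exact: (measurable_funPT (y s)). Qed.

Lemma measurable_astarX t :
  measurable_fun [set: T] (fun om => astarX t om : borel_cV R (p + q)).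
Proof. exact: (measurableT_comp measurable_astar (measurable_X t)). Qed.

Lemma prob_lags (A : set (borel_cV R p)) s t : measurable A ->
  P (lags p y t @^-1` A) = P (lags p y s @^-1` A).
Proof. by move=> mA; rewrite (eq_law_lags t ystat mA) -(eq_law_lags s ystat mA). Qed.

Lemma Ex_lags (b : borel_cV R p -> R) s t : measurable_fun setT b ->
  (forall x, 0 <= b x) ->
  Ex P (fun om => b (lags p y t om)) = Ex P (fun om => b (lags p y s om)).
Proof.
move=> mb b0; rewrite /Ex /Rintegral; congr fine.
have ml u : measurable_fun [set: T] (lags p y u : T -> borel_cV R p).
  by apply: measurable_lags => s'; exact: (measurable_funPT (y s')).
have E u : (\int[P]_om (b (lags p y u om))%:E =
    \int[pushforward P (lags p y u : T -> borel_cV R p)]_x (b x)%:E)%E.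
  rewrite (@ge0_integral_pushforward _ _ _ _ _ _ (ml u) P setT (fun x => (b x)%:E))//.
    exact/measurable_EFinP.
  by move=> x _; rewrite lee_fin.
rewrite !E; apply: eq_measure_integral => A mA _.
exact: (prob_lags s t mA).
Qed.

Variable gamma : R.
Hypothesis gamma_gt2 : 2 < gamma.
Hypothesis moment_gamma : forall t : int,
  ('E_P[(fun om => norm2 (astarX t om) `^ gamma)%R] < +oo)%E.

Let mN t : measurable_fun setT (fun om => norm2 (astarX t om)).
Proof. exact: (measurableT_comp (@measurable_norm2 R _) (measurable_astarX t)). Qed.

Lemma L1_norm_gamma t : L1 P (fun om => norm2 (astarX t om) `^ gamma).
Proof.
apply: L1_ge0 => [||//]; last by move=> om; exact: powR_ge0.
exact: (measurableT_comp (measurable_powR gamma) (mN t)).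
Qed.

Lemma L1_norm_sqr t : L1 P (fun om => norm2 (astarX t om) ^+ 2).
Proof.
apply: (L1_le _ (L1D (L1_cst P 1) (L1_norm_gamma t))); first exact: measurable_funX.
move=> om; set x := norm2 _; have x0 : 0 <= x by exact: norm2_ge0.
rewrite ger0_norm ?sqr_ge0//.
have [x1|x1] := leP x 1.
  apply: (@le_trans _ _ 1); first by rewrite expr_le1.
  by rewrite lerDl powR_ge0.
rewrite -powR_mulrn// (@le_trans _ _ (x `^ gamma))//; last by rewrite lerDr.
by apply: ler_powR; rewrite ltW.
Qed.

Lemma L1_coord_sqr t i : L1 P (fun om => astarX t om i 0 ^+ 2).
Proof.
apply: (L1_le _ (L1_norm_sqr t)).
  apply: measurable_funX; exact: (measurable_cV_coord i (measurable_astarX t)).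
move=> om; rewrite ger0_norm ?sqr_ge0// -real_normK ?num_real//.
by rewrite ler_pXn2r ?nnegrE ?norm2_ge0//; exact: ler_coord_norm2.
Qed.

Lemma Ex_norm_sqr t :
  Ex P (fun om => norm2 (astarX t om) ^+ 2) = Ex P (fun om => norm2 (astarX 0 om) ^+ 2).
Proof.
apply: (Ex_lags (b := fun x => norm2 (astar w phi x) ^+ 2)).
  apply: measurable_funX.
  exact: (measurableT_comp (@measurable_norm2 R _) measurable_astar).
by move=> x; exact: sqr_ge0.
Qed.

Lemma Ex_norm_gamma t :
  Ex P (fun om => norm2 (astarX t om) `^ gamma) =
  Ex P (fun om => norm2 (astarX 0 om) `^ gamma).
Proof.
apply: (Ex_lags (b := fun x => norm2 (astar w phi x) `^ gamma)).
  apply: (measurableT_comp (measurable_powR gamma)).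
  exact: (measurableT_comp (@measurable_norm2 R _) measurable_astar).
by move=> x; exact: powR_ge0.
Qed.

Hypothesis g_posdef : forall t : int,
  posdef (second_moment P (gmom w phi y t beta0)).

(** The bracket in the moment function is 1/2 or -1/2, so positive definiteness passes to the second
    moments of [astar]. *)
Lemma sqr_dotp_gmom u t om :
  dotp u (gmom w phi y t beta0 om) ^+ 2 = 4^-1 * dotp u (astarX t om) ^+ 2.
Proof.
rewrite /gmom dotpZr exprMn; congr (_ * _).
by case: (_ <= 0) => /=; field.
Qed.

Lemma Ex_dotp_sqr_ge : exists2 lam : R, 0 < lam &
  forall u, lam * norm2 u ^+ 2 <= Ex P (fun om => dotp u (astarX 0 om) ^+ 2).
Proof.
have [lam lam0 lamP] := posdef_lower_bound (g_posdef 0).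
exists (4 * lam); first by rewrite mulr_gt0.
move=> u.
pose g := gmom w phi y 0 beta0.
have mg i : measurable_fun setT (fun om => g om i 0).
  rewrite (_ : (fun om => _) = fun om => (2^-1 - (\1_`]-oo, 0%R] (y 0 om - dotp beta0 (X 0 om)))) * astarX 0 om i 0).
    apply: measurable_funM; last exact: (measurable_cV_coord i (measurable_astarX 0)).
    apply: measurable_funB => //.
    have mI : measurable_fun setT (\1_`]-oo, 0%R] : R -> R) by exact: measurable_indic.
    apply: (measurableT_comp mI); apply: measurable_funB => //.
    exact: (measurableT_comp (measurable_dotp beta0) (measurable_X 0)).
  apply/funext => om; rewrite /g /gmom mxE indicE; congr ((_ - _) * _).
  by rewrite dotpC mem_setE in_itv.
have g2 i : L1 P (fun om => g om i 0 ^+ 2).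
  apply: (L1_le _ (L1_coord_sqr 0 i)); first exact: measurable_funX.
  move=> om; rewrite ger0_norm ?sqr_ge0// /g /gmom mxE exprMn ler_piMl ?sqr_ge0//.
  by case: (_ <= 0) => /=; lra.
have gg i j : L1 P (fun om => g om i 0 * g om j 0) by exact: L1_mul.
have -> : Ex P (fun om => dotp u (astarX 0 om) ^+ 2) =
    4 * (u^T *m second_moment P g *m u) 0 0; last by rewrite -mulrA ler_pM2l.
rewrite (@eq_Ex _ _ _ P _ (fun om => \sum_i \sum_j (4 * u i 0 * u j 0) * (g om i 0 * g om j 0))).
  rewrite Ex_sum; last by move=> i; apply: L1_sum => j; exact: L1Z.
  rewrite -mulmxA mxE mulr_sumr; apply: eq_bigr => i _.
  rewrite Ex_sum; last by move=> j; exact: L1Z.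
  rewrite !mxE mulr_sumr mulr_sumr; apply: eq_bigr => j _.
  by rewrite ExZ// !mxE Ex_fine; ring.
move=> om; have /(canRL (mulKf _)) := esym (sqr_dotp_gmom u 0 om).
rewrite invrK => ->; last by rewrite invr_eq0.
rewrite dotpE expr2 big_distrl/= mulr_sumr; apply: eq_bigr => i _.
rewrite big_distrr/= mulr_sumr; apply: eq_bigr => j _; rewrite -/g; ring.
Qed.

(* Paley-Zygmund: the [gamma]-moment keeps the second moment of [u'a*] from
   being carried by large values only. *)
Lemma prob_dotp_ge : exists tau eta : R, [/\ 0 < tau, 0 < eta &
  forall u, 2^-1 <= norm2 u -> forall t,
    2 * eta <= fine (P [set om | tau < `|dotp u (astarX t om)|]%R)].
Proof.
have [lam lam0 lamP] := Ex_dotp_sqr_ge.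
pose E := Ex P (fun om => norm2 (astarX 0 om) `^ gamma).
have E0 : 0 <= E by apply: Ex_ge0 => om; exact: powR_ge0.
(* The second moment, at least [lam], is split in three: values up to [tau0] give at most [lam / 4],
   norms above [K] give at most [E / L <= lam / 4] since [K^(gamma - 2) = L], and the rest gives at
   most [K^2] times the probability sought. *)
pose L := 4 * (E + 1) / lam.
have L0 : 0 < L by rewrite divr_gt0// mulr_gt0//; lra.
have EL : E / L <= lam / 4.
  rewrite ler_pdivrMr// (_ : lam / 4 * L = E + 1); first by rewrite lerDl.
  by rewrite /L; field; rewrite gt_eqF.
have g20 : 0 < gamma - 2 by rewrite subr_gt0.
pose K := L `^ (gamma - 2)^-1.
have K0 : 0 < K by rewrite powR_gt0.
have KL : K `^ (gamma - 2) = L by rewrite /K -powRrM mulVf ?gt_eqF// powRr1// ltW.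
pose tau0 := Num.sqrt (lam / 4).
have tau00 : 0 < tau0 by rewrite sqrtr_gt0 divr_gt0.
have tau02 : tau0 ^+ 2 = lam / 4 by rewrite sqr_sqrtr// ltW// divr_gt0.
pose A u : set (borel_cV R p) := [set x | tau0 < `|dotp u (astar w phi x)|].
have mA u : measurable (A u).
  have mf : measurable_fun setT (fun x : borel_cV R p => `|dotp u (astar w phi x)|).
    apply: measurableT_comp => //; exact: (measurableT_comp (measurable_dotp u) measurable_astar).
  have := mf measurableT `]tau0, +oo[%classic (measurable_itv _); rewrite setTI.
  by congr measurable; apply/seteqP; split => x /=; rewrite in_itv/= andbT.
have unit_case u t : norm2 u = 1 ->
    lam / (2 * K ^+ 2) <= fine (P [set om | tau0 < `|dotp u (astarX t om)|]%R).
  move=> u1.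
  have -> : P [set om | tau0 < `|dotp u (astarX t om)|]%R = P (lags p y (0 - 1) @^-1` A u).
    exact: (prob_lags (0 - 1) (t - 1) (mA u)).
  set B := lags p y (0 - 1) @^-1` A u.
  have mB : measurable B.
    by have := measurable_X 0 measurableT (mA u); rewrite setTI.
  have := lamP u; rewrite u1 expr1n mulr1 => h.
  have : Ex P (fun om => dotp u (astarX 0 om) ^+ 2) <=
    Ex P (fun om => lam / 4 + (K ^+ 2 * \1_B om + L^-1 * norm2 (astarX 0 om) `^ gamma)).
    have L1r : L1 P (fun om => lam / 4 + (K ^+ 2 * \1_B om + L^-1 * norm2 (astarX 0 om) `^ gamma)).
      apply: L1D; first exact: L1_cst.
      apply: L1D; first exact/L1Z/L1_indic.
      by apply: L1Z; exact: L1_norm_gamma.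
    have pw om : dotp u (astarX 0 om) ^+ 2 <=
        lam / 4 + (K ^+ 2 * \1_B om + L^-1 * norm2 (astarX 0 om) `^ gamma).
      set N := norm2 (astarX 0 om); have N0 : 0 <= N by exact: norm2_ge0.
      have uN : `|dotp u (astarX 0 om)| <= N.
        by rewrite (le_trans (CauchySchwarz_dotp _ _))// u1 mul1r.
      have uN2 : dotp u (astarX 0 om) ^+ 2 <= N ^+ 2.
        by rewrite -real_normK ?num_real// ler_pXn2r ?nnegrE.
      have Ng : 0 <= L^-1 * N `^ gamma by rewrite mulr_ge0 ?powR_ge0// invr_ge0 ltW.
      have I0 : 0 <= K ^+ 2 * \1_B om by rewrite mulr_ge0 ?sqr_ge0// indicE ler0n.
      have [KN|NK] := leP K N.
        have Np : 0 < N := lt_le_trans K0 KN.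
        apply: (le_trans uN2); apply: (@le_trans _ _ (L^-1 * N `^ gamma)); last first.
          by rewrite addrA lerDr addr_ge0// ltW// divr_gt0.
        have Ngam : N `^ gamma = N ^+ 2 * N `^ (gamma - 2).
          rewrite -powR_mulrn// -powRD; last by rewrite (gt_eqF Np) implybT.
          by congr (_ `^ _); ring.
        rewrite mulrC ler_pdivlMr// -KL Ngam ler_wpM2l ?sqr_ge0//.
        by apply: ge0_ler_powR => //; rewrite ?nnegrE// ltW.
      have [Bom|nB] := pselect (B om).
        rewrite indicE mem_set// mulr1 addrCA -[leLHS]addr0 lerD//.
          by rewrite (le_trans uN2)// ler_pXn2r ?nnegrE// ltW.
        by rewrite addr_ge0// ltW// divr_gt0.
      rewrite -[leLHS]addr0 lerD ?addr_ge0// -tau02 -real_normK ?num_real//.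
      rewrite ler_pXn2r ?nnegrE ?(ltW tau00)// leNgt; exact/negP.
    apply: Ex_le => //; apply: (L1_le _ L1r).
      apply: measurable_funX.
      exact: (measurableT_comp (measurable_dotp u) (measurable_astarX 0)).
    by move=> om; rewrite ger0_norm ?sqr_ge0.
  rewrite ExD; [|exact: L1_cst|by apply: L1D; [exact/L1Z/L1_indic|exact/L1Z/L1_norm_gamma]].
  rewrite ExD; [|exact/L1Z/L1_indic|exact/L1Z/L1_norm_gamma].
  rewrite Ex_cst !ExZ; [|exact: L1_norm_gamma|exact: L1_indic].
  rewrite Ex_indic// -/E [L^-1 * _]mulrC => h2.
  rewrite ler_pdivrMr ?mulr_gt0 ?exprn_gt0//.
  move: h h2 EL; set pB := fine _; move: (E / L) => z; lra.
have eta0 : 0 < lam / (2 * K ^+ 2) by rewrite divr_gt0// mulr_gt0// exprn_gt0.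
(* [tau0] is halved to pass from unit vectors to norm at least 1/2; the second halving only undoes
   the factor 2 in the statement. *)
exists (tau0 / 2), (lam / (2 * K ^+ 2) / 2); split; [exact: divr_gt0|exact: divr_gt0|].
move=> u u2 t; rewrite mulrCA divff// mulr1.
have un : 0 < norm2 u by apply: lt_le_trans u2; rewrite invr_gt0.
pose u' := (norm2 u)^-1 *: u.
have u'1 : norm2 u' = 1 by rewrite norm2Z gtr0_norm ?invr_gt0// mulVf// gt_eqF.
apply: le_trans (unit_case u' t u'1) _.
have mS (c : R) (x : 'cV[R]_(p + q)) : measurable [set om | c < `|dotp x (astarX t om)|].
  have mf : measurable_fun setT (fun om => `|dotp x (astarX t om)|).
    apply: measurableT_comp => //; exact: (measurableT_comp (measurable_dotp x) (measurable_astarX t)).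
  have := mf measurableT `]c, +oo[%classic (measurable_itv _); rewrite setTI.
  by congr measurable; apply/seteqP; split => om /=; rewrite in_itv/= andbT.
apply: fine_le; rewrite ?fin_num_measure//.
apply: le_measure; rewrite ?inE// => om /=.
rewrite dotpZl normrM gtr0_norm ?invr_gt0// => h.
rewrite ltr_pdivrMr//; apply: lt_le_trans h _.
rewrite mulrC ler_wpM2l// -[2]invrK lef_pV2 ?posrE ?invr_gt0//.
Qed.

End Moments.

Lemma indic_bool (R : realType) (U : Type) (b : U -> bool) (x : U) :
  \1_[set z | b z] x = (b x)%:R :> R.
Proof. by rewrite indicE; congr (_%:R); congr nat_of_bool; apply/idP/idP; rewrite inE. Qed.

Lemma exists_nat_ge (R : realType) (x : R) :
  exists k0, forall k, (k0 <= k)%N -> (0 < k)%N /\ x <= k%:R.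
Proof.
exists (Num.truncn x).+1 => k xk; split; first exact: leq_trans xk.
by rewrite ltW// (lt_le_trans (truncnS_gt x))// ler_nat.
Qed.

(** * The innovation law near zero *)

Section Innovations.
Context {R : realType} {d : measure_display} {T : measurableType d}.
Variable P : probability T R.
Variables (e : int -> {RV P >-> R}) (f : R -> R).
Hypothesis e_density : forall t, has_density (e t) f.

Let mE t (A : set R) : measurable A -> measurable (e t @^-1` A).
Proof. by move=> mA; rewrite -[X in measurable X]setTI; exact: (measurable_funPT (e t)). Qed.

Lemma prob_innovation_eq0 t : P (e t @^-1` [set 0]) = 0%E.
Proof.
have [_ _ ->] := e_density t; last exact: measurable_set1.
exact: integral_set1.
Qed.

Lemma ae_innovation_neq0 : {ae P, forall om, forall n : nat, e n%:Z om != 0}.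
Proof.
apply: ae_foralln => n; exists (e n @^-1` [set 0]); split.
- exact: mE.
- exact: prob_innovation_eq0.
- by move=> om /= /negP; rewrite negbK => /eqP.
Qed.

(** A density leaves no atom at 0, so the two median inequalities meet; this exact value centres the
    score. *)
Lemma prob_innovation_le0 : is_median (e 0) 0 ->
  fine (P (e 0 @^-1` `]-oo, 0])) = 2^-1.
Proof.
move=> [h1 h2].
have mN : measurable (e 0 @^-1` `]-oo, (0:R)[) by apply: mE; exact: measurable_itv.
have mP : measurable (e 0 @^-1` `]-oo, (0:R)]) by apply: mE; exact: measurable_itv.
have E1 : P (e 0 @^-1` `]-oo, 0]) = P (e 0 @^-1` `]-oo, (0:R)[).
  have -> : e 0 @^-1` `]-oo, 0] = e 0 @^-1` `]-oo, (0:R)[ `|` e 0 @^-1` [set 0].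
    rewrite -preimage_setU; congr (_ @^-1` _); apply/seteqP; split => x /=.
      by rewrite !in_itv/= le_eqVlt => /orP[/eqP|]; [right|left].
    by rewrite !in_itv/= => -[/ltW//|->].
  rewrite measureU//; last first.
    by apply/seteqP; split => // om [/=]; rewrite in_itv/= => h h'; rewrite h' ltxx in h.
  rewrite -[RHS]adde0; congr (_ + _)%E; exact: prob_innovation_eq0.
have E2 : e 0 @^-1` `[0, +oo[ = ~` (e 0 @^-1` `]-oo, (0:R)[).
  by apply/seteqP; split => om /=; rewrite !in_itv/= andbT leNgt => /negP.
move: h2; rewrite E2 probability_setC// -E1.
have -> : P (e 0 @^-1` `]-oo, 0]) = (fine (P (e 0 @^-1` `]-oo, 0])))%:E.
  by rewrite fineK// fin_num_measure.
move: h1; rewrite -[P _]fineK ?fin_num_measure// lee_fin => h1.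
by rewrite -EFinB lee_fin/=; lra.
Qed.

(** The innovations for which [e <= x] and [e <= 0] differ, for [x = s] or [x = - s]; closing the
    right end matches the non-strict indicator. *)
Definition half_itv (neg : bool) (s : R) : set R :=
  if neg then `]- s, 0]%classic else `]0, s]%classic.

Lemma measurable_half_itv neg s : measurable (half_itv neg s).
Proof. by rewrite /half_itv; case: neg; exact: measurable_itv. Qed.

(** Close to 0 the difference quotients of the distribution function exceed half the derivative.
    Differentiability is known at 0 only, so the intervals have 0 as an endpoint. *)
Lemma prob_half_itv_ge : is_derive (0 : R) (1 : R) (dist_fun (e 0)) (f 0) -> 0 < f 0 ->
  exists2 s0 : R, 0 < s0 & forall neg s, 0 < s <= s0 ->
    f 0 / 2 * s <= fine (P (e 0 @^-1` half_itv neg s)).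
Proof.
move=> [dF DF] f0.
have := dF; rewrite /derivable => /cvg_ex[l cvl].
have lE : l = f 0 by rewrite -DF /derive; apply/esym/cvg_lim.
rewrite lE in cvl.
have f20 : 0 < f 0 / 2 by rewrite divr_gt0.
move/cvgrPdist_lt : cvl => /(_ _ f20).
move=> /nbhs_ballP[s1 /= s10 h].
have key x : x != 0 -> `|x| < s1 ->
    f 0 / 2 <= x^-1 * (dist_fun (e 0) x - dist_fun (e 0) 0).
  move=> x0 xs; have := h x; rewrite /ball/= sub0r normrN => /(_ xs x0).
  rewrite /= addr0 -[x *: 1]/(x * 1) mulr1 ltr_norml => /andP[_].
  by rewrite -[_ *: _]/(_ * _); lra.
exists (s1 / 2); first by rewrite divr_gt0.
have split_itv (a b : R) : a <= b ->
    fine (P (e 0 @^-1` `]a, b])) = dist_fun (e 0) b - dist_fun (e 0) a.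
  move=> ab; rewrite /dist_fun /cdf /distribution /pushforward.
  have -> : e 0 @^-1` `]-oo, b] = e 0 @^-1` `]-oo, a] `|` e 0 @^-1` `]a, b].
    rewrite -preimage_setU; congr (_ @^-1` _); apply/seteqP; split => x /=.
      by rewrite !in_itv/= => ->; rewrite andbT; have [|] := leP x a; [left|right].
    by rewrite !in_itv/= => -[/le_trans|/andP[]//]; apply.
  have dis : e 0 @^-1` `]-oo, a] `&` e 0 @^-1` `]a, b] = set0.
    apply/seteqP; split => // om [/=]; rewrite !in_itv/= => h1 /andP[h2 _].
    by have := lt_le_trans h2 h1; rewrite ltxx.
  have mA : measurable (e 0 @^-1` `]-oo, a]) by apply: mE; exact: measurable_itv.
  have mB : measurable (e 0 @^-1` `]a, b]) by apply: mE; exact: measurable_itv.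
  by rewrite [in RHS]measureU// fineD ?fin_num_measure// addrC addKr.
move=> neg s /andP[s0 ss].
have s1s : `|s| < s1 by rewrite gtr0_norm// (le_lt_trans ss)// ltr_pdivrMr// ltr_pMr// ltr1n.
case: neg; rewrite /half_itv split_itv; [|by rewrite oppr_le0 ltW| |exact: ltW].
  have := key (- s); rewrite oppr_eq0 (gt_eqF s0) normrN => /(_ isT s1s).
  by rewrite invrN mulNr -mulrN opprB [s^-1 * _]mulrC ler_pdivlMr.
have := key s; rewrite (gt_eqF s0) => /(_ isT s1s).
by rewrite [s^-1 * _]mulrC ler_pdivlMr.
Qed.

End Innovations.

(** * Events of high probability *)

Section Events.
Context {R : realType} {d : measure_display} {T : measurableType d}.
Variable P : probability T R.
Variables (p q : nat) (e y : int -> {RV P >-> R}) (f : R -> R).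
Variables (w : 'cV[R]_p -> R) (phi : 'cV[R]_p -> 'cV[R]_q) (gamma : R).
Hypothesis e_indep : mutually_independent e.
Hypothesis e_ident : identically_distributed e.
Hypothesis ystat : strictly_stationary y.
Hypothesis ycausal : causal e y.
Hypothesis w_gt0 : forall x, 0 < w x.
Hypothesis w_meas : measurable_fun [set: borel_cV R p] (w : borel_cV R p -> R).
Hypothesis phi_meas : measurable_fun [set: borel_cV R p]
  (phi : borel_cV R p -> borel_cV R q).
Hypothesis gamma_gt2 : 2 < gamma.

Local Notation X t := (lags p y (t - 1)).
Local Notation astarX t om := (astar w phi (X t om)).
(** Time of the [i]-th observation of a block that follows time [a0]: [a0] is 0 for the first block
    and [k] for the second. *)
Local Notation tm a0 i := ((a0 + i).+1%:Z).

Hypothesis moment_gamma : forall t : int,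
  ('E_P[(fun om => norm2 (astarX t om) `^ gamma)%R] < +oo)%E.
Hypothesis e_median : is_median (e 0) 0.
Hypothesis e_density : forall t, has_density (e t) f.

Let m_astar := measurable_astar w_meas phi_meas.
Let m_astarX t : measurable_fun [set: T] (fun om => astarX t om : borel_cV R (p + q)).
Proof. exact: measurable_astarX. Qed.
Let m_X t : measurable_fun [set: T] (X t : T -> borel_cV R p).
Proof. exact: measurable_X. Qed.
Let mN t : measurable_fun setT (fun om => norm2 (astarX t om)).
Proof. exact: (measurableT_comp (@measurable_norm2 R _) (m_astarX t)). Qed.
Let L1sqr := L1_norm_sqr w_meas phi_meas gamma_gt2 moment_gamma.
Let L1gam := L1_norm_gamma w_meas phi_meas moment_gamma.

Let K2 := Ex P (fun om => norm2 (astarX 0 om) ^+ 2).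
Let Kg := Ex P (fun om => norm2 (astarX 0 om) `^ gamma).

Lemma whp_score (j : 'I_(p + q)) (a0 k : nat) (a : R) : 0 < a ->
  whp P (k%:R * (2^-1 * K2) / a ^+ 2)
    (fun om => `|\sum_(i < k) ((e (tm a0 i) om <= 0)%R%:R - 2^-1) *
                              astarX (tm a0 i) om j 0| < a).
Proof.
move=> a_gt0.
have mC : measurable (`]-oo, 0]%classic : set R) by exact: measurable_itv.
have mb : measurable_fun setT (fun x : borel_cV R p => astar w phi x j 0).
  exact: (measurable_cV_coord j m_astar).
have b2 t : L1 P (fun om => astar w phi (lags p y t om) j 0 ^+ 2).
  have := L1_coord_sqr w_meas phi_meas gamma_gt2 moment_gamma (t + 1) j.
  by rewrite addrK.
have bB t : Ex P (fun om => astar w phi (lags p y t om) j 0 ^+ 2) <= K2.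
  rewrite /K2 -(Ex_norm_sqr w_meas phi_meas ystat (t + 1)) addrK.
  apply: Ex_le => //; first by have := L1sqr (t + 1); rewrite addrK.
  move=> om; rewrite -real_normK ?num_real//.
  by rewrite ler_pXn2r ?nnegrE ?norm2_ge0//; exact: ler_coord_norm2.
have := whp_innovation_sum e_indep e_ident ycausal mC mb b2 a0 k a_gt0 bB.
rewrite (prob_innovation_le0 e_density e_median); apply: whpS => om.
rewrite /innovation_term (prob_innovation_le0 e_density e_median).
by under eq_bigr do rewrite indicE mem_setE in_itv.
Qed.

Lemma whp_score_norm (eps : R) : 0 < eps -> exists2 Z : R, 0 < Z &
  forall k a0, (0 < k)%N -> whp P eps
    (fun om => norm2 (\sum_(i < k) ((e (tm a0 i) om <= 0)%R%:R - 2^-1) *: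
                        astarX (tm a0 i) om) <= Z * Num.sqrt k%:R).
Proof.
move=> eps0.
have K20 : 0 <= K2 by apply: Ex_ge0 => om; exact: sqr_ge0.
(* The failure probability is [(p + q) K2 / (2 Z0^2)]; the added 1 gives [Z0 <= Z0^2], which brings
   it below [eps]. *)
pose Z0 := (p + q)%:R * K2 / 2 / eps + 1.
have Z01 : 1 <= Z0.
  by rewrite lerDr; apply: divr_ge0 (ltW eps0); apply: divr_ge0 => //; exact: mulr_ge0.
have Z00 : 0 < Z0 := lt_le_trans ltr01 Z01.
exists ((p + q)%:R * Z0 + 1); first by rewrite ltr_wpDl// mulr_ge0// ltW.
move=> k a0 k0; have kR : 0 < k%:R :> R by rewrite ltr0n.
set rk := Num.sqrt k%:R; have rk0 : 0 < rk by rewrite sqrtr_gt0.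
have rk2 : rk ^+ 2 = k%:R by rewrite sqr_sqrtr// ltW.
have ev : whp P ((p + q)%:R * (k%:R * (2^-1 * K2) / (Z0 * rk) ^+ 2)) (fun om =>
    forall j : 'I_(p + q), `|\sum_(i < k) ((e (tm a0 i) om <= 0)%R%:R - 2^-1) *
                              astarX (tm a0 i) om j 0| < Z0 * rk).
  rewrite -[Y in Y%:R * _]card_ord; apply: whp_forall => j.
  by apply: whp_score; exact: mulr_gt0.
apply: (whp_le _ (whpS _ ev)).
  rewrite exprMn rk2 (_ : _ * _ = (p + q)%:R * K2 / 2 / Z0 ^+ 2); last first.
    by field; rewrite !gt_eqF.
  rewrite ler_pdivrMr ?exprn_gt0// [eps * _]mulrC -ler_pdivrMr//.
  apply: (@le_trans _ _ Z0); first by rewrite lerDl.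
  by rewrite expr2 ler_pMr.
move=> om h; apply: le_trans (norm2_le_sum _) _.
apply: (@le_trans _ _ (\sum_(j < p + q) (Z0 * rk))).
  apply: ler_sum => j _; rewrite summxE; apply: le_trans (ltW (h j)).
  by under eq_bigr do rewrite mxE.
by rewrite sumr_const card_ord -[leLHS]mulr_natl mulrA ler_pM2r// lerDl.
Qed.

(** Markov with the [gamma]-th moment and a union bound give [k Kg / (mu sqrt k)^gamma], of order
    [k^(1 - gamma/2)], which vanishes as [gamma > 2]. *)
Lemma whp_max (eps mu : R) : 0 < eps -> 0 < mu ->
  exists k0, forall k, (k0 <= k)%N -> forall a0,
    whp P eps (fun om => forall i : 'I_k, norm2 (astarX (tm a0 i) om) < mu * Num.sqrt k%:R).
Proof.
move=> eps0 mu0.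
have Kg0 : 0 <= Kg by apply: Ex_ge0 => om; exact: powR_ge0.
pose A := Kg / (mu `^ gamma * eps) + 1.
have A0 : 0 < A.
  by rewrite ltr_wpDl// divr_ge0// mulr_ge0 ?powR_ge0// ltW.
have g20 : 0 < gamma - 2 by rewrite subr_gt0.
have [k0 k0P] := exists_nat_ge ((A `^ (gamma - 2)^-1) ^+ 2).
exists k0 => k /k0P[k_gt0 Ak] a0.
have kR : 0 < k%:R :> R by rewrite ltr0n.
set s := Num.sqrt k%:R; have s0 : 0 < s by rewrite sqrtr_gt0.
have s2 : s ^+ 2 = k%:R by rewrite sqr_sqrtr// ltW.
have As : A <= s `^ (gamma - 2).
  have : A `^ (gamma - 2)^-1 <= s by rewrite -(@ler_pXn2r _ 2) ?nnegrE ?powR_ge0 ?sqrtr_ge0// s2.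
  move=> /(ge0_ler_powR (ltW g20)).
  rewrite -powRrM mulVf ?gt_eqF// powRr1 ?(ltW A0)//; apply.
    by rewrite nnegrE powR_ge0.
  by rewrite nnegrE ltW.
have msg : (mu * s) `^ gamma = mu `^ gamma * (k%:R * s `^ (gamma - 2)).
  rewrite powRM ?ltW//; congr (_ * _).
  rewrite -s2 -powR_mulrn ?ltW// -powRD; last by rewrite (gt_eqF s0) implybT.
  by congr (_ `^ _); ring.
have ms0 : 0 < (mu * s) `^ gamma by rewrite powR_gt0// mulr_gt0.
have g0 : 0 < gamma by rewrite (lt_trans _ gamma_gt2).
apply: (@whp_le _ _ _ _ (#|'I_k|%:R * (Kg / (mu * s) `^ gamma))).
  rewrite card_ord mulrA ler_pdivrMr// msg.
  rewrite (_ : eps * _ = k%:R * (s `^ (gamma - 2) * (mu `^ gamma * eps))); last by ring.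
  rewrite ler_pM2l// -ler_pdivrMr ?mulr_gt0 ?powR_gt0//.
  by apply: le_trans As; rewrite lerDl.
apply: whp_forall => i.
apply: whpS (whp_markov (B := Kg) (L1gam (tm a0 i)) (fun om => powR_ge0 _ _) ms0 _).
  move=> om h; rewrite ltNge; apply/negP => h'.
  move: h; apply/negP; rewrite -leNgt; apply: ge0_ler_powR => //; first exact: ltW.
    by rewrite nnegrE mulr_ge0// ltW.
  by rewrite nnegrE norm2_ge0.
by rewrite (Ex_norm_gamma w_meas phi_meas ystat gamma (tm a0 i)) lexx.
Qed.

Lemma whp_sum_norm_sqr (K : R) (a0 k : nat) : 0 < K -> (0 < k)%N ->
  whp P (K2 / K) (fun om => \sum_(i < k) norm2 (astarX (tm a0 i) om) ^+ 2 < K * k%:R).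
Proof.
move=> K0 k0; have kR : 0 < k%:R :> R by rewrite ltr0n.
apply: (@whp_le _ _ _ _ (k%:R * K2 / (K * k%:R))).
  by rewrite [K * _]mulrC -mulf_div divff ?gt_eqF// mul1r.
apply: whp_markov.
- by apply: L1_sum => i; exact: L1sqr.
- by move=> om; apply: sumr_ge0 => i _; exact: sqr_ge0.
- by rewrite mulr_gt0.
- rewrite Ex_sum; last by move=> i; exact: L1sqr.
  under eq_bigr do rewrite (Ex_norm_sqr w_meas phi_meas ystat).
  by rewrite sumr_const card_ord mulr_natl lexx.
Qed.

(* Everything that must stay bounded on the sample points that are counted. *)
Definition size_of (x : 'cV[R]_p) : R :=
  w x + (w x)^-1 + \sum_i `|x i 0| + \sum_i `|astar w phi x i 0|.

Lemma size_of_ge x : [/\ w x <= size_of x, (w x)^-1 <= size_of x,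
  \sum_i `|x i 0| <= size_of x & \sum_i `|astar w phi x i 0| <= size_of x].
Proof.
have h1 := w_gt0 x; have h2 : 0 < (w x)^-1 by rewrite invr_gt0.
have h3 : 0 <= \sum_i `|x i 0| by exact: sumr_ge0.
have h4 : 0 <= \sum_i `|astar w phi x i 0| by exact: sumr_ge0.
rewrite /size_of; split; lra.
Qed.

Lemma measurable_size_of : measurable_fun [set: borel_cV R p] (size_of : borel_cV R p -> R).
Proof.
apply: measurable_funD; first apply: measurable_funD; first apply: measurable_funD => //.
- rewrite (_ : (fun x => (w x)^-1) = fun x => w x `^ (-1)).
    by apply: (measurableT_comp (measurable_powR (-1))).
  by apply/funext => x; rewrite powR_inv1// ltW.
- apply: measurable_sum => i; apply: measurableT_comp => //; exact: measurable_coord.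
- apply: measurable_sum => i; apply: measurableT_comp => //.
  exact: (measurable_cV_coord i m_astar).
Qed.

(** Continuity from above at one time, since [size_of] is finite everywhere; stationarity carries
    the same [K] to all times. *)
Lemma size_of_tail (delta : R) : 0 < delta -> exists2 K : R, 0 < K &
  forall t, fine (P [set om | K < size_of (X t om)]%R) <= delta.
Proof.
move=> delta0.
pose A n : set (borel_cV R p) := [set x | n%:R < size_of x].
have mA n : measurable (A n).
  have := measurable_size_of measurableT (measurable_itv `]n%:R, +oo[); rewrite setTI.
  by congr measurable; apply/seteqP; split => x /=; rewrite in_itv/= andbT.
pose F n := X 0 @^-1` A n.
have mF n : measurable (F n) by have := m_X 0 measurableT (mA n); rewrite setTI.
have F0 : \bigcap_n F n = set0.
  apply/seteqP; split => // om /(_ (Num.truncn (size_of (X 0 om))).+1 I).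
  by rewrite /F /A/= => /(lt_trans (truncnS_gt _)); rewrite ltxx.
have : P \o F @ \oo --> P (\bigcap_n F n).
  apply: nonincreasing_cvg_mu => //.
  - by rewrite -ge0_fin_numE// fin_num_measure.
  - by rewrite F0.
  - move=> m n mn; apply/subsetPset => om; rewrite /F /A/=.
    by apply: le_lt_trans; rewrite ler_nat.
rewrite F0 measure0 => /fine_cvgP[_].
move/cvgrPdist_le => /(_ _ delta0)[n _ /(_ n.+1)].
rewrite /= => /(_ (leqnSn n)); rewrite sub0r normrN ger0_norm ?fine_ge0// => h.
exists n.+1%:R; first by rewrite ltr0n.
move=> t; have -> : P [set om | n.+1%:R < size_of (X t om)]%R = P (F n.+1).
  exact: (prob_lags ystat (0 - 1) (t - 1) (mA n.+1)).
exact: h.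
Qed.

Lemma whp_size_of (delta : R) : 0 < delta -> exists2 K : R, 0 < K &
  forall (c : R) (a0 k : nat), 0 < c -> (0 < k)%N ->
    whp P (delta / c)
      (fun om => \sum_(i < k) (K < size_of (X (tm a0 i) om))%R%:R < c * k%:R).
Proof.
move=> /size_of_tail[K K0 hK]; exists K => // c a0 k c0 k0.
have kR : 0 < k%:R :> R by rewrite ltr0n.
pose A t := [set om | K < size_of (X t om)].
have mA t : measurable (A t).
  have := (measurableT_comp measurable_size_of (m_X t)) measurableT _ (measurable_itv `]K, +oo[).
  rewrite setTI; congr measurable; apply/seteqP.
  by split => om /=; rewrite in_itv/= andbT.
apply: (@whp_le _ _ _ _ (k%:R * delta / (c * k%:R))).
  by rewrite [c * _]mulrC -mulf_div divff ?gt_eqF// mul1r.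
have L1A t : L1 P (fun om => (K < size_of (X t om))%R%:R).
  rewrite (_ : (fun om => _) = \1_(A t)); first exact: L1_indic.
  by apply/funext => om; rewrite indic_bool.
apply: whp_markov.
- by apply: L1_sum => i; exact: L1A.
- by move=> om; apply: sumr_ge0 => i _; rewrite ler0n.
- by rewrite mulr_gt0.
- rewrite Ex_sum; last by move=> i; exact: L1A.
  apply: le_trans (_ : \sum_(i < k) delta <= _); last by rewrite sumr_const card_ord mulr_natl lexx.
  apply: ler_sum => i _; apply: le_trans (hK (tm a0 i)).
  rewrite -/(A (tm a0 i)) -Ex_indic// (@eq_Ex _ _ _ P _ (\1_(A (tm a0 i))))// => om.
  by rewrite indic_bool.
Qed.

Variables (tau eta C : R).
Hypotheses (tau_gt0 : 0 < tau) (eta_gt0 : 0 < eta).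
Hypothesis dotp_prob : forall u, 2^-1 <= norm2 u -> forall t,
  2 * eta <= fine (P [set om | tau < `|dotp u (astarX t om)|]%R).

Lemma measurable_signed_astarX t : measurable_fun [set: T]
  ((fun om => Num.sg (e t om) *: astarX t om) : T -> borel_cV R (p + q)).
Proof.
apply: measurable_borel_cV => i.
rewrite (_ : (fun om => _) = fun om => Num.sg (e t om) * astarX t om i 0); last first.
  by apply/funext => om; rewrite mxE.
apply: measurable_funM; last exact: (measurable_cV_coord i (m_astarX t)).
have msg : measurable_fun setT (fun x : R => Num.sg x).
  rewrite (_ : (fun x => _) = fun x : R => \1_`]0, +oo[ x - \1_`]-oo, 0[ x).
    by apply: measurable_funB; apply: measurable_indic; exact: measurable_itv.
  apply/funext => x; rewrite !indicE !mem_setE !in_itv/= andbT.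
  by case: sgrP; rewrite ?subr0 ?sub0r// ltxx subrr.
exact: (measurableT_comp msg).
Qed.

Let v (t : int) (om : T) := Num.sg (e t om) *: astarX t om.
Let m_v t : measurable_fun [set: T] (v t : T -> borel_cV R (p + q)).
Proof. exact: measurable_signed_astarX. Qed.
Hypothesis alpha_sum : forall n, \sum_(i < n) alpha_mixing P v i.+1 <= C.

(* The moduli [|u'v_t|] and [|u'a*(X_{t-1})|] agree since [e_t] has no atom at 0,
   so the frequencies are governed by the mixing coefficients of [v]. *)
Lemma whp_frequency u (a0 k : nat) : 2^-1 <= norm2 u -> (0 < k)%N ->
  whp P (k%:R * (1 + 2 * C) / (eta * k%:R) ^+ 2)
    (fun om => eta * k%:R < \sum_(i < k) (tau < `|dotp u (astarX (tm a0 i) om)|)%R%:R).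
Proof.
move=> u2 k0; have kR : 0 < k%:R :> R by rewrite ltr0n.
pose A : set (borel_cV R (p + q)) := [set x | tau < `|dotp u (x : 'cV[R]_(p + q))|].
have mA : measurable A.
  have mf : measurable_fun setT (fun x : borel_cV R (p + q) => `|dotp u (x : 'cV[R]_(p + q))|).
    by apply: measurableT_comp => //; exact: measurable_dotp.
  have := mf measurableT `]tau, +oo[%classic (measurable_itv _); rewrite setTI.
  by congr measurable; apply/seteqP; split => x /=; rewrite in_itv/= andbT.
have ek : 0 < eta * k%:R by rewrite mulr_gt0.
have sgA om t : e t om != 0 ->
    (\1_A (v t om) : R) = (tau < `|dotp u (astarX t om)|)%R%:R.
  move=> e0; rewrite /A indic_bool /v dotpZr normrM normr_sg e0 mul1r//.
have PA i : 2 * eta <= fine (P (v (tm a0 i) @^-1` A)).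
  apply: le_trans (dotp_prob u2 (tm a0 i)) _.
  set B := [set om | _].
  have mB : measurable B by have := m_astarX (tm a0 i) measurableT mA; rewrite setTI.
  have mV : measurable (v (tm a0 i) @^-1` A).
    by have := m_v (tm a0 i) measurableT mA; rewrite setTI.
  rewrite -!Ex_indic// (@ae_eq_Ex _ _ _ P _ (\1_(v (tm a0 i) @^-1` A)))//.
  apply: filterS (ae_innovation_neq0 e_density) => om /(_ (a0 + i).+1) /(sgA om).
  by move=> h; rewrite [LHS]indic_bool -h !indicE.
have := whp_and (whp_mixing_sum m_v a0 k alpha_sum mA ek)
  (whp_ae (ae_innovation_neq0 e_density)).
rewrite addr0; apply: whpS => om [h e0].
move: h; rewrite sumrB => h.
have hs : \sum_(i < k) (\1_A (v (tm a0 i) om) : R) =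
    \sum_(i < k) (tau < `|dotp u (astarX (tm a0 i) om)|)%R%:R.
  by apply: eq_bigr => i _; rewrite sgA.
have hp : 2 * eta * k%:R <= \sum_(i < k) fine (P (v (tm a0 i) @^-1` A)).
  have -> : 2 * eta * k%:R = \sum_(i < k) (2 * eta).
    by rewrite sumr_const card_ord mulr_natr.
  by apply: ler_sum => i _; exact: PA.
move: h; rewrite hs ltr_norml => /andP[h _].
move: h hp; set S := \sum_(i < k) _; set S' := \sum_(i < k) _ => h hp.
have E : 2 * eta * k%:R = eta * k%:R + eta * k%:R by ring.
by move: h hp; rewrite E; move: (eta * k%:R) => z; lra.
Qed.

(** At a point of size at most [K], moving [u] to a grid neighbour changes its product with [astar]
    by at most [K / N <= tau / 2]. Oversized points number at most [eta / 2 * k], half of the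
    frequency guaranteed on the grid. *)
Lemma whp_good_frequency (eps : R) : 0 < eps -> exists2 K : R, 0 < K &
  exists k0, forall k, (k0 <= k)%N -> forall a0,
  whp P eps (fun om => forall u, norm2 u = 1 ->
    eta / 2 * k%:R <= \sum_(i < k)
     ((size_of (X (tm a0 i) om) <= K) &&
      (tau / 2 < `|dotp u (astarX (tm a0 i) om)|))%R%:R).
Proof.
move=> eps0.
have dl0 : 0 < eps / 2 * (eta / 2) by rewrite !(mulr_gt0, divr_gt0).
have [K K0 hK] := whp_size_of dl0.
(* The first summand makes [K / N <= tau / 2]; the second keeps the grid neighbours of unit vectors
   at norm at least 1/2. *)
have [N NP] := exists_nat_ge (2 * K / tau + 2 * (p + q)%:R).
have [N0 NK] := NP N (leqnn N).
have NR : 0 < N%:R :> R by rewrite ltr0n.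
have KN : N%:R^-1 * K <= tau / 2.
  rewrite mulrC ler_pdivrMr//.
  have : 2 * K / tau <= N%:R by apply: le_trans NK; rewrite lerDl.
  rewrite ler_pdivrMr// => h; rewrite mulrAC ler_pdivlMr//; lra.
have mN2 : (p + q)%:R * N%:R^-1 <= 2^-1 :> R.
  rewrite ler_pdivrMr// mulrC ler_pdivlMr// mulrC.
  apply: le_trans NK; rewrite lerDr; apply: divr_ge0; last exact: ltW.
  by apply: mulr_ge0 => //; exact: ltW.
pose I := {ffun 'I_(p + q) -> 'I_(N.*2.+1)}.
have C1 : 0 <= C by have := alpha_sum 0; rewrite big_ord0.
pose D : R := (1 + 2 * C) / eta ^+ 2.
have D0 : 0 <= D by rewrite divr_ge0 ?sqr_ge0//; lra.
have [k0 k0P] := exists_nat_ge (#|I|%:R * D / (eps / 2)).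
exists K => //; exists k0 => k /k0P[k_gt0 kD] a0.
have kR : 0 < k%:R :> R by rewrite ltr0n.
have e20 : 0 < eta / 2 by exact: divr_gt0.
have ev1 := hK (eta / 2) a0 k e20 k_gt0.
have ev2 : whp P (#|I|%:R * (k%:R * (1 + 2 * C) / (eta * k%:R) ^+ 2))
  (fun om => forall g : I, 2^-1 <= norm2 (grid_point g : 'cV[R]_(p + q)) ->
     eta * k%:R < \sum_(i < k) (tau < `|dotp (grid_point g) (astarX (tm a0 i) om)|)%R%:R).
  apply: whp_forall => g.
  have [g2|g2] := leP 2^-1 (norm2 (grid_point g : 'cV[R]_(p + q))).
    by apply: whpS (whp_frequency a0 g2 k_gt0).
  (* For a grid point of norm below 1/2 the event is vacuous. *)
  exists set0; split => //; rewrite measure0 lee_fin.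
  by rewrite divr_ge0 ?sqr_ge0// mulr_ge0//; lra.
apply: (whp_le _ (whpS _ (whp_and ev1 ev2))).
  rewrite mulfK ?gt_eqF ?divr_gt0// [leRHS]splitr lerD2l.
  have -> : #|I|%:R * (k%:R * (1 + 2 * C) / (eta * k%:R) ^+ 2) = #|I|%:R * D / k%:R.
    by rewrite /D; field; rewrite !gt_eqF.
  have eps20 : 0 < eps / 2 by exact: divr_gt0.
  by rewrite ler_pdivrMr// [eps / 2 * _]mulrC -ler_pdivrMr.
move=> om [h1 h2] u u1.
have [g gP] : exists g : I, forall i, `|u i 0 - grid_point g i 0| <= N%:R^-1.
  by apply: grid_approx => // i; rewrite (le_trans (ler_coord_norm2 _ _))// u1.
have := h2 g (norm2_grid_ge u1 gP mN2).
set S1 := \sum_(i < k) _ => hS1.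
have : S1 <= \sum_(i < k) ((size_of (X (tm a0 i) om) <= K) &&
      (tau / 2 < `|dotp u (astarX (tm a0 i) om)|))%R%:R +
      \sum_(i < k) (K < size_of (X (tm a0 i) om))%R%:R.
  rewrite -big_split/=; apply: ler_sum => i _.
  have [big|small] := ltP K (size_of (X (tm a0 i) om)).
    by rewrite /= add0r; case: (_ < _).
  rewrite /= addr0 ler_nat.
  have [h|//] := ltP tau `|dotp (grid_point g) (astarX (tm a0 i) om)|; rewrite lt0b.
  have [_ _ _ sz] := size_of_ge (X (tm a0 i) om).
  have := dist_dotp_le (astarX (tm a0 i) om) gP.
  have := ler_wpM2l (ltW (_ : 0 < N%:R^-1 :> R)) (le_trans sz small).
  rewrite invr_gt0 => /(_ NR) b1 b2.
  have := ler_normD (dotp (grid_point g) (astarX (tm a0 i) om) - dotp u (astarX (tm a0 i) om))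
     (dotp u (astarX (tm a0 i) om)).
  rewrite subrK distrC; lra.
move=> hS2; move: hS1 hS2 h1; set S2 := \sum_(i < k) _; set S3 := \sum_(i < k) _.
rewrite [eta / 2 * _]mulrAC; move: (eta * k%:R) => z; lra.
Qed.

(** By homogeneity [u] may be normalized; then each of the [eta / 2 * k] good points contributes at
    least [(tau / 2)^2], whence the 8. *)
Lemma whp_gram (eps : R) : 0 < eps -> exists k0, forall k, (k0 <= k)%N -> forall a0,
  whp P eps (fun om => forall u,
    tau ^+ 2 * eta / 8 * k%:R * norm2 u ^+ 2 <=
    \sum_(i < k) dotp u (astarX (tm a0 i) om) ^+ 2).
Proof.
move=> /whp_good_frequency[K K0 [k0 k0P]]; exists k0 => k /k0P h a0.
apply: whpS (h a0) => om hu u.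
have [/norm2_eq0 ->|u0] := eqVneq (norm2 u) 0.
  rewrite (_ : norm2 0 = 0) ?expr0n ?mulr0; first by apply: sumr_ge0 => i _; exact: sqr_ge0.
  by rewrite -(scale0r (0 : 'cV[R]_(p + q))) norm2Z normr0 mul0r.
have up : 0 < norm2 u by rewrite lt_def u0 norm2_ge0.
pose u' := (norm2 u)^-1 *: u.
have u'1 : norm2 u' = 1 by rewrite norm2Z gtr0_norm ?invr_gt0// mulVf.
have uE : u = norm2 u *: u' by rewrite /u' scalerA divff// scale1r.
rewrite {2}uE; under eq_bigr do rewrite dotpZl exprMn.
rewrite -mulr_sumr mulrC ler_pM2l ?exprn_gt0//.
apply: le_trans (_ : (tau / 2) ^+ 2 * (eta / 2 * k%:R) <= _).
  by rewrite le_eqVlt; apply/orP; left; apply/eqP; field.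
apply: le_trans (ler_wpM2l (sqr_ge0 _) (hu _ u'1)) _.
rewrite mulr_sumr; apply: ler_sum => i _.
have [/andP[_ h1]|_] := boolP (_ && _); last by rewrite mulr0 sqr_ge0.
rewrite mulr1 -[leRHS]real_normK ?num_real// ler_pXn2r ?nnegrE ?normr_ge0 ?ltW//.
by rewrite divr_gt0.
Qed.

End Events.

(** * Drift of the score away from the truth *)

Section Drift.
Context {R : realType} {d : measure_display} {T : measurableType d}.
Variable P : probability T R.
Variables (p q : nat) (e y : int -> {RV P >-> R}) (f : R -> R).
Variables (w : 'cV[R]_p -> R) (phi : 'cV[R]_p -> 'cV[R]_q).
Hypothesis e_indep : mutually_independent e.
Hypothesis e_ident : identically_distributed e.
Hypothesis ycausal : causal e y.
Hypothesis w_gt0 : forall x, 0 < w x.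
Hypothesis w_meas : measurable_fun [set: borel_cV R p] (w : borel_cV R p -> R).
Hypothesis phi_meas : measurable_fun [set: borel_cV R p]
  (phi : borel_cV R p -> borel_cV R q).
Hypothesis F_deriv : is_derive (0 : R) (1 : R) (dist_fun (e 0)) (f 0).
Hypothesis f0_gt0 : 0 < f 0.

Local Notation X t := (lags p y (t - 1)).
Local Notation astarX t om := (astar w phi (X t om)).
Local Notation tm a0 i := ((a0 + i).+1%:Z).

(* The increment, from [beta0] to [beta0 + rho u], of the component of the
   moment function in the direction [- u]. *)
Definition drift_term (rho : R) (u : 'cV[R]_p) (t : int) (om : T) : R :=
  w (X t om) * dotp u (X t om) *
  ((e t om <= rho * dotp u (X t om))%R%:R - (e t om <= 0)%R%:R).

(** The difference of indicators has the sign of [u'X], because [rho * u'X] lies on that side of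
    0. *)
Lemma drift_term_ge0 rho u t om : 0 <= rho -> 0 <= drift_term rho u t om.
Proof.
move=> rho0; rewrite /drift_term -mulrA pmulr_rge0//.
set D := dotp _ _; set E := e t om.
have [D0|D0] := leP 0 D.
  rewrite mulr_ge0// subr_ge0 ler_nat.
  have [E0|//] := leP E 0; rewrite lt0b.
  by rewrite (le_trans E0)// mulr_ge0.
rewrite mulr_le0 ?(ltW D0)// subr_le0 ler_nat.
have [E0|//] := leP E (rho * D); rewrite lt0b.
by rewrite (le_trans E0)// mulr_ge0_le0// ltW.
Qed.

(** The innovation lies between 0 and [rho u'X], so the difference of indicators is 1 or -1 with the
    sign of [u'X]; the size bound gives [w >= 1 / K]. *)
Lemma drift_term_ge (neg : bool) (rho s K : R) u t om : 0 < rho -> 0 < s ->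
  0 < K -> size_of w phi (X t om) <= K -> s <= (-1) ^+ neg * dotp u (X t om) ->
  half_itv neg (rho * s) (e t om) -> s / K <= drift_term rho u t om.
Proof.
move=> rho0 s0 K0 sz; have [_ wK _ _] := size_of_ge phi w_gt0 (X t om).
have {}wK : K^-1 <= w (X t om).
  by rewrite -[leRHS]invrK lef_pV2 ?posrE ?invr_gt0// (le_trans wK).
rewrite /drift_term; set D := dotp _ _; set E := e t om; set W := w _ in wK *.
rewrite [s / K]mulrC /half_itv; case: neg => /=; rewrite in_itv/= ?expr1 ?expr0 => hD /andP[h1 h2].
  rewrite h2 (_ : (E <= rho * D) = false); last first.
    apply/negbTE; rewrite -ltNge; apply: le_lt_trans h1.
    by rewrite -mulrN ler_pM2l//; lra.
  rewrite sub0r mulrN1 -mulrN; apply: ler_pM; rewrite ?invr_ge0 ?(ltW s0) ?(ltW K0)//; lra.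
rewrite (_ : (E <= rho * D) = true); last first.
  by apply: le_trans h2 _; rewrite ler_pM2l//; lra.
rewrite [E <= 0]leNgt h1 /= subr0 mulr1.
apply: ler_pM; rewrite ?invr_ge0 ?(ltW s0) ?(ltW K0)//; lra.
Qed.

Lemma norm2_col_mx0 (u : 'cV[R]_p) : norm2 (col_mx u (0 : 'cV[R]_q)) = norm2 u.
Proof.
rewrite /norm2 big_split_ord/= [Y in _ + Y]big1 ?addr0; last first.
  by move=> i _; rewrite col_mxEd mxE expr0n.
by congr Num.sqrt; apply: eq_bigr => i _; rewrite col_mxEu.
Qed.

Lemma dotp_col_mx0 (u x : 'cV[R]_p) :
  dotp (col_mx u (0 : 'cV[R]_q)) (astar w phi x) = w x * dotp u x.
Proof.
rewrite /astar dotpZr; congr (_ * _); rewrite !dotpE big_split_ord/=.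
rewrite [Y in _ + Y]big1 ?addr0; last by move=> i _; rewrite col_mxEd mxE mul0r.
by apply: eq_bigr => i _; rewrite /avec !col_mxEu.
Qed.

Variables (tau eta : R).
Hypotheses (tau_gt0 : 0 < tau) (eta_gt0 : 0 < eta).
Hypothesis good_frequency : forall eps : R, 0 < eps -> exists2 K : R, 0 < K &
  exists k0, forall k, (k0 <= k)%N -> forall a0,
  whp P eps (fun om => forall u, norm2 u = 1 ->
    eta / 2 * k%:R <= \sum_(i < k)
     ((size_of w phi (X (tm a0 i) om) <= K) &&
      (tau / 2 < `|dotp u (astarX (tm a0 i) om)|))%R%:R).

(** The constants depend on [eps] but not on [rho], which lets the radius be chosen from [c]. For a
    fixed grid direction and sign, whether a point counts depends on the regressors alone, so the
    number of counted points whose innovation falls in the short interval is compared with its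
    conditional mean. *)
Lemma whp_drift (eps : R) : 0 < eps -> exists c rho0 A : R, exists k0,
  [/\ 0 < c, 0 < rho0 & forall k, (k0 <= k)%N -> forall rho, 0 < rho <= rho0 ->
    A <= k%:R * rho -> forall a0,
    whp P eps (fun om => forall u, norm2 u = 1 ->
      c * (k%:R * rho) <= \sum_(i < k) drift_term rho u (tm a0 i) om)].
Proof.
move=> eps0; have eps20 : 0 < eps / 2 by exact: divr_gt0.
have [K K0 [k0 good]] := good_frequency eps20.
(* [w <= K] and [|w u'X| > tau / 2] force [|u'X| > 4s]. Passing to the grid direction costs [s] and
   leaves more than [2s]; passing back costs another [s]. *)
pose s := tau / (8 * K).
have s_gt0 : 0 < s by rewrite divr_gt0// mulr_gt0.
have sK : s * K = tau / 8 by rewrite /s; field; rewrite gt_eqF.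
have [N NP] := exists_nat_ge (K / s).
have [N0 NK] := NP N (leqnn N).
have NR : 0 < N%:R :> R by rewrite ltr0n.
have KN : N%:R^-1 * K <= s by rewrite mulrC ler_pdivrMr// mulrC -ler_pdivrMr.
have [s1 s10 ps] := prob_half_itv_ge F_deriv f0_gt0.
pose I := ({ffun 'I_p -> 'I_(N.*2.+1)} * bool)%type.
(* Chebyshev gives [64 / (eta^2 k)] over the interval probability, which is at least
   [f 0 / 2 * rho * s]; together this is [D / (k rho)]. *)
pose D := 128 / (eta ^+ 2 * f 0 * s).
have D0 : 0 < D.
  apply: divr_gt0 => //; apply: mulr_gt0 => //; apply: mulr_gt0 => //.
  exact: exprn_gt0.
(* Least drift [s / K] of a counted point, times the fraction [eta / 8] that survives, times the
   interval probability per unit of [rho]. The second constant keeps [rho * s] within [s1]; the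
   third makes the union bound over grid and signs at most [eps / 2]. *)
exists (s / K * (eta / 8 * (f 0 / 2 * s))), (s1 / s), (#|{: I}|%:R * D / (eps / 2)), (maxn 1 k0).
split; [|exact: divr_gt0|].
  apply: mulr_gt0; first exact: divr_gt0.
  by apply: mulr_gt0; [exact: divr_gt0|apply: mulr_gt0 => //; exact: divr_gt0].
move=> k; rewrite geq_max => /andP[k_gt0 k0k] rho /andP[rho_gt0 rho1] kA a0.
have kR : 0 < k%:R :> R by rewrite ltr0n.
have rs : 0 < rho * s <= s1 by rewrite mulr_gt0//= -ler_pdivlMr.
pose pr (neg : bool) := fine (P (e 0 @^-1` half_itv neg (rho * s))).
have pr_ge neg : f 0 / 2 * (rho * s) <= pr neg by exact: ps.
have frs0 : 0 < f 0 / 2 * (rho * s).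
  by apply: mulr_gt0; [exact: divr_gt0|case/andP: rs].
have pr0 neg : 0 < pr neg by apply: lt_le_trans (pr_ge neg).
pose A (h : I) : set (borel_cV R p) := [set x | (size_of w phi x <= K) &&
   (2 * s < (-1) ^+ h.2 * dotp (grid_point h.1) x)].
have mA h : measurable (A h).
  have -> : A h = [set x | size_of w phi x <= K] `&`
      [set x | 2 * s < (-1) ^+ h.2 * dotp (grid_point h.1) x].
    by apply/seteqP; split => [x /andP[]|x [h1 h2]] //; exact/andP.
  apply: measurableI.
    have := (measurable_size_of w_gt0 w_meas phi_meas) measurableT _ (measurable_itv `]-oo, K]).
    by rewrite setTI; congr measurable; apply/seteqP; split => x /=; rewrite in_itv.
  have mf : measurable_fun setT (fun x : borel_cV R p => (-1) ^+ h.2 * dotp (grid_point h.1) x).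
    by apply: measurable_funM => //; exact: measurable_dotp.
  have := mf measurableT _ (measurable_itv `]2 * s, +oo[).
  by rewrite setTI; congr measurable; apply/seteqP; split => x /=; rewrite in_itv/= andbT.
pose b h : borel_cV R p -> R := \1_(A h).
have b01 h x : b h x = 0 \/ b h x = 1.
  by rewrite /b indicE; case: (_ \in _); [right|left].
have mb h : measurable_fun setT (b h) by exact: measurable_indic.
have b2 h t : L1 P (fun om => b h (lags p y t om) ^+ 2).
  apply: (@L1_bounded _ _ _ _ _ 1).
    apply: measurable_funX; apply: (measurableT_comp (mb h)).
    by apply: measurable_lags => t'; exact: (measurable_funPT (y t')).
  by move=> om; case: (b01 h (lags p y t om)) => ->; rewrite ?expr0n ?expr1n ?normr0 ?normr1.
have bB h t : Ex P (fun om => b h (lags p y t om) ^+ 2) <= 1.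
  rewrite -[leRHS](@Ex_cst _ _ _ P); apply: Ex_le => //; first exact: L1_cst.
  by move=> om; case: (b01 h (lags p y t om)) => ->; rewrite ?expr0n ?expr1n.
have ev1 : whp P (#|{: I}|%:R * (D / (k%:R * rho))) (fun om => forall h : I,
    `|\sum_(i < k) innovation_term e y (half_itv h.2 (rho * s)) (b h) (tm a0 i) om|
      < eta / 8 * k%:R * pr h.2).
  apply: whp_forall => h.
  have a_gt0 : 0 < eta / 8 * k%:R * pr h.2 by rewrite !mulr_gt0// divr_gt0.
  apply: whp_le (whp_innovation_sum e_indep e_ident ycausal (measurable_half_itv _ _)
    (mb h) (b2 h) a0 k a_gt0 (bB h)).
  rewrite -/(pr h.2) mulr1.
  have -> : k%:R * pr h.2 / (eta / 8 * k%:R * pr h.2) ^+ 2 =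
      64 / (eta ^+ 2 * k%:R) * (pr h.2)^-1.
    by field; rewrite !gt_eqF.
  have -> : D / (k%:R * rho) = 64 / (eta ^+ 2 * k%:R) * (f 0 / 2 * (rho * s))^-1.
    by rewrite /D; field; rewrite !gt_eqF.
  rewrite ler_pM2l ?divr_gt0 ?mulr_gt0 ?exprn_gt0//.
  by rewrite lef_pV2 ?posrE.
apply: (whp_le _ (whpS _ (whp_and (good k k0k a0) ev1))).
  rewrite [leRHS]splitr lerD2l mulrA ler_pdivrMr ?mulr_gt0//.
  by rewrite [eps / 2 * _]mulrC -ler_pdivrMr.
move=> om [h1 h2] u u1.
have [g gP] : exists g : {ffun 'I_p -> 'I_(N.*2.+1)}, forall i, `|u i 0 - grid_point g i 0| <= N%:R^-1.
  by apply: grid_approx => // i; rewrite (le_trans (ler_coord_norm2 _ _))// u1.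
have close t : size_of w phi (X t om) <= K ->
    `|dotp u (X t om) - dotp (grid_point g) (X t om)| <= s.
  move=> szK; have [_ _ sz _] := size_of_ge phi w_gt0 (X t om).
  apply: le_trans (dist_dotp_le _ gP) _; apply: le_trans KN.
  by rewrite ler_wpM2l ?invr_ge0// (le_trans sz).
have := h1 (col_mx u 0); rewrite norm2_col_mx0 u1 => /(_ erefl) hcount.
pose cnt neg := \sum_(i < k) b (g, neg) (X (tm a0 i) om).
have hcnt : eta / 2 * k%:R <= cnt false + cnt true.
  apply: le_trans hcount _; rewrite /cnt -big_split/=; apply: ler_sum => i _.
  set t := tm a0 i; rewrite dotp_col_mx0 /b !indic_bool/= expr0 expr1 mul1r mulN1r.
  case: (leP (size_of w phi (X t om)) K) => [szK|_] /=; last by rewrite addr0.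
  have [wK _ _ _] := size_of_ge phi w_gt0 (X t om).
  have := close t szK; set x := dotp u _; set z := dotp (grid_point g) _ => xz.
  rewrite -natrD ler_nat; have [h|//] := ltP (tau / 2) `|w (X t om) * x|.
  rewrite normrM gtr0_norm// in h.
  have {}h : 4 * s < `|x|.
    rewrite -(ltr_pM2l K0) (_ : K * (4 * s) = tau / 2); last first.
      by rewrite mulrC -mulrA sK; field.
    by apply: lt_le_trans h _; rewrite ler_wpM2r// (le_trans wK).
  have : 2 * s < `|z|.
    have := ler_normD (x - z) z; rewrite subrK; lra.
  by rewrite ltr_normr => /orP[->|->]; rewrite ?addn1.
(* One of the two signs of [u'X] carries half of the good points; the deviation bound [eta / 8] then
   takes half of what is left. *)
have [neg hneg] : exists neg, eta / 4 * k%:R <= cnt neg.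
  have [hf|hf] := leP (eta / 4 * k%:R) (cnt false); first by exists false.
  by exists true; lra.
have := h2 (g, neg); rewrite /= ltr_norml => /andP[+ _].
rewrite /innovation_term -/(pr neg).
set S := \sum_(i < k) \1_(half_itv neg (rho * s)) (e (tm a0 i) om) * b (g, neg) (X (tm a0 i) om).
have -> : \sum_(i < k) (\1_(half_itv neg (rho * s)) (e (tm a0 i) om) - pr neg) *
    b (g, neg) (X (tm a0 i) om) = S - pr neg * cnt neg.
  by rewrite /S /cnt mulr_sumr -sumrB; apply: eq_bigr => i _; rewrite mulrBl.
move=> hS.
have S_ge : eta / 8 * k%:R * pr neg <= S.
  have := ler_wpM2l (ltW (pr0 neg)) hneg; lra.
have drift_ge : s / K * S <= \sum_(i < k) drift_term rho u (tm a0 i) om.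
  rewrite /S mulr_sumr; apply: ler_sum => i _; set t := tm a0 i.
  have d0 : 0 <= drift_term rho u t om by apply: drift_term_ge0; exact: ltW.
  rewrite indicE; have [et|_] := boolP (_ \in _); last by rewrite mul0r mulr0.
  rewrite /b indic_bool; case: andP => [[szK hz]|_]; last by rewrite !mulr0.
  rewrite !mulr1; apply: (drift_term_ge rho_gt0 s_gt0 K0 szK _ (set_mem et)).
  have := close t szK; rewrite /= in hz; rewrite ler_norml => /andP[c1 c2].
  case: neg hz {hneg hS S_ge et S} => /=; rewrite ?expr1 ?expr0; lra.
apply: le_trans drift_ge.
have sK0 : 0 < s / K by exact: divr_gt0.
rewrite -[leLHS]mulrA (ler_pM2l sK0); apply: le_trans S_ge.
rewrite (_ : _ * (k%:R * rho) = eta / 8 * k%:R * (f 0 / 2 * (rho * s))); last by ring.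
by rewrite ler_pM2l// mulr_gt0// divr_gt0.
Qed.

End Drift.

(** * Comparison of the likelihood at the truth and at the estimator *)

(** The shape [0 + i] matches [tm 0 i], so that both blocks are treated alike. *)
Lemma sum_first_block (V : nmodType) (n k : nat) (F : nat -> V) : (k <= n)%N ->
  \sum_(i < n | (i < k)%N) F i = \sum_(i < k) F (0 + i)%N.
Proof. by move=> kn; rewrite (big_ord_widen _ (fun i => F (0 + i)%N) kn). Qed.

Lemma sum_second_block (V : nmodType) (n k : nat) (F : nat -> V) :
  \sum_(i < n | (k <= i)%N) F i = \sum_(i < n - k) F (k + i)%N.
Proof.
rewrite -(big_geq_mkord k n predT F) -{1}[k]add0n big_addn big_mkord.
by apply: eq_bigr => i _; rewrite addnC.
Qed.

Section Comparison.
Context {R : realType} {d : measure_display} {T : measurableType d}.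
Variable P : probability T R.
Variables (p q : nat) (e y : int -> {RV P >-> R}).
Variables (w : 'cV[R]_p -> R) (phi : 'cV[R]_p -> 'cV[R]_q) (beta0 : 'cV[R]_p).
Hypothesis w_gt0 : forall x, 0 < w x.

Local Notation X t := (lags p y (t - 1)).
Local Notation astarX t om := (astar w phi (X t om)).
Local Notation tm a0 i := ((a0 + i).+1%:Z).

Variable om : T.
Hypothesis ARom : forall i : nat,
  y i.+1%:Z om = dotp (X i.+1%:Z om) beta0 + e i.+1%:Z om.

Let score (t : int) : 'cV[R]_(p + q) :=
  ((e t om <= 0)%R%:R - 2^-1) *: astarX t om.

Lemma gmom_truth i : gmom w phi y i.+1%:Z beta0 om = - score i.+1%:Z.
Proof. by rewrite /gmom ARom addrAC subrr add0r /score -scaleNr opprB. Qed.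

(** What the probabilistic part supplies about a block. The sample point is fixed in this section,
    so the arguments that use it are deterministic. *)
Definition regular_block (cG mu Z : R) (a0 m : nat) : Prop :=
  [/\ forall u, cG * m%:R * norm2 u ^+ 2 <= \sum_(i < m) dotp u (astarX (tm a0 i) om) ^+ 2,
      forall i : 'I_m, norm2 (astarX (tm a0 i) om) < mu * Num.sqrt m%:R &
      norm2 (\sum_(i < m) score (tm a0 i)) <= Z * Num.sqrt m%:R].

Lemma norm2N m (x : 'cV[R]_m) : norm2 (- x) = norm2 x.
Proof. by rewrite -scaleN1r norm2Z normrN1 mul1r. Qed.

Lemma norm2_score t : norm2 (score t) = 2^-1 * norm2 (astarX t om).
Proof.
rewrite norm2Z; congr (_ * _); case: (_ <= 0) => /=.
  by rewrite ger0_norm; lra.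
by rewrite sub0r normrN ger0_norm.
Qed.

Lemma dotp_score_sqr u t :
  dotp u (- score t) ^+ 2 = 4^-1 * dotp u (astarX t om) ^+ 2.
Proof.
rewrite -scaleNr dotpZr exprMn; congr (_ * _).
by case: (_ <= 0) => /=; field.
Qed.

(** At the truth the moment function is [astar] times 1/2 or -1/2: the Gram constant becomes
    [cG / 4], the maximum [mu / 2], and the exponent constant 3 becomes 12. The block enters through
    [A] and [a0], so both blocks are covered. *)
Lemma truth_block_weights (n a0 m : nat) (A : pred 'I_n) (cG mu Z : R) :
  (0 < m)%N -> 0 < cG -> 0 <= mu -> 0 <= Z -> 4 * Z * mu <= cG ->
  #|A| = m ->
  (forall (V : nmodType) (F : nat -> V),
     \sum_(i < n | A i) F i = \sum_(i < m) F (a0 + i)%N) ->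
  (forall i : 'I_n, A i -> exists j : 'I_m, val i = (a0 + j)%N) ->
  regular_block cG mu Z a0 m ->
  exists v : 'I_n -> R, [/\ forall i, A i -> 0 <= v i <= 1,
    \sum_(i < n | A i) v i = 1,
    \sum_(i < n | A i) v i *: gmom w phi y i.+1%:Z beta0 om = 0 &
    expR (- (12 * Z ^+ 2 / cG)) <= \prod_(i < n | A i) (m%:R * v i)].
Proof.
move=> m0 cG0 mu0 Z0 Zmu cardA sumA inA [gram max sc].
have c0 : 0 < cG / 4 by exact: divr_gt0.
have -> : 12 * Z ^+ 2 / cG = 3 * Z ^+ 2 / (cG / 4) by field; rewrite gt_eqF.
rewrite -cardA.
apply: (@prod_scaled_weights_ge_expR R _ A _
  (fun i => gmom w phi y i.+1%:Z beta0 om) (cG / 4) Z (mu / 2)) => //.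
- by rewrite cardA.
- by rewrite divr_ge0.
- move=> u; rewrite (eq_bigr (fun i : 'I_n => 4^-1 * dotp u (astarX (val i).+1%:Z om) ^+ 2)); last first.
    by move=> i _; rewrite gmom_truth dotp_score_sqr.
  rewrite (sumA _ (fun i => 4^-1 * dotp u (astarX i.+1%:Z om) ^+ 2)) -mulr_sumr cardA.
  have := gram u; set S := \sum_(i < m) _; lra.
- rewrite (eq_bigr (fun i : 'I_n => - score (val i).+1%:Z)); last first.
    by move=> i _; rewrite gmom_truth.
  by rewrite (sumA _ (fun i => - score i.+1%:Z)) sumrN norm2N cardA.
- move=> i Ai; have [j ij] := inA i Ai.
  rewrite gmom_truth norm2N norm2_score cardA ij.
  by have := max j; lra.
- rewrite ler_pdivrMr//; lra.
Qed.

Lemma el_sup_truth (n k : nat) (cG mu Z : R) : (0 < k < n)%N ->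
  0 < cG -> 0 <= mu -> 0 <= Z -> 4 * Z * mu <= cG ->
  regular_block cG mu Z 0 k -> regular_block cG mu Z k (n - k) ->
  expR (- (24 * Z ^+ 2 / cG)) <=
    el_sup k (fun i : 'I_n => gmom w phi y i.+1%:Z beta0 om)
             (fun i : 'I_n => gmom w phi y i.+1%:Z beta0 om).
Proof.
move=> /andP[k0 kn] cG0 mu0 Z0 Zmu b1 b2.
have kn' := ltnW kn.
have [v1 [v1_01 v1_1 v1_g v1_p]] := @truth_block_weights n 0 k (fun i => (i < k)%N) _ _ _
  k0 cG0 mu0 Z0 Zmu (card_first_block kn') (fun V F => sum_first_block F kn')
  (fun i ik => ex_intro (fun j : 'I_k => val i = (0 + j)%N) (Ordinal ik) erefl) b1.
have nk : (0 < n - k)%N by rewrite subn_gt0.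
have in2 (i : 'I_n) : (k <= i)%N -> exists j : 'I_(n - k), val i = (k + j)%N.
  move=> ki; have h : (i - k < n - k)%N by rewrite ltn_sub2r.
  by exists (Ordinal h); rewrite /= subnKC.
have [v2 [v2_01 v2_1 v2_g v2_p]] := @truth_block_weights n k (n - k) (fun i => (k <= i)%N) _ _ _
  nk cG0 mu0 Z0 Zmu (card_second_block kn') (fun V F => sum_second_block n k F)
  in2 b2.
pose v (i : 'I_n) := if (i < k)%N then v1 i else v2 i.
have v_1 (i : 'I_n) : (i < k)%N -> v i = v1 i by rewrite /v => ->.
have v_2 (i : 'I_n) : (k <= i)%N -> v i = v2 i by rewrite /v ltnNge => ->.
have gv : el_weights k (fun i : 'I_n => gmom w phi y i.+1%:Z beta0 om)
             (fun i : 'I_n => gmom w phi y i.+1%:Z beta0 om) v.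
  split.
  - by move=> i; have [ki|ik] := leqP k i; [rewrite v_2//; exact: v2_01|rewrite v_1//; exact: v1_01].
  - by rewrite -v1_1; apply: eq_bigr => i /v_1.
  - by rewrite -v2_1; apply: eq_bigr => i /v_2.
  - by rewrite -[RHS]v1_g; apply: eq_bigr => i /v_1 ->.
  - by rewrite -[RHS]v2_g; apply: eq_bigr => i /v_2 ->.
apply: le_trans (el_sup_ge kn' gv).
have -> : - (24 * Z ^+ 2 / cG) = - (12 * Z ^+ 2 / cG) + - (12 * Z ^+ 2 / cG).
  by field; rewrite gt_eqF.
rewrite expRD /el_product; apply: ler_pM; rewrite ?expR_ge0//.
  by apply: le_trans v1_p _; rewrite le_eqVlt; apply/orP; left; apply/eqP/eq_bigr => i /v_1 ->.
by apply: le_trans v2_p _; rewrite le_eqVlt; apply/orP; left; apply/eqP/eq_bigr => i /v_2 ->.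
Qed.

(* The multiplier is [-u / sqrt k] in the first [p] coordinates, with [u] the
   direction of [b - beta0]; since the drift is nondecreasing along rays, its
   value at distance [rho] is a lower bound for its value at [b]. *)
Lemma el_sup_far (n k : nat) (b : 'cV[R]_p) (cG mu Z K D rho : R) : (0 < k < n)%N ->
  mu <= 1 -> 0 < rho -> rho < norm2 (b - beta0) ->
  regular_block cG mu Z 0 k ->
  \sum_(i < k) norm2 (astarX (tm 0 i) om) ^+ 2 < K * k%:R ->
  (forall u, norm2 u = 1 -> D <= \sum_(i < k) drift_term e y w rho u (tm 0 i) om) ->
  el_sup k (fun i : 'I_n => gmom w phi y i.+1%:Z b om)
           (fun i : 'I_n => gmom w phi y i.+1%:Z b om) <=
  expR (K / 2 + Z - D / Num.sqrt k%:R).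
Proof.
move=> /andP[k0 kn] mu1 rho0 far [_ max sc] sumsq drift.
have kn' := ltnW kn.
have kR : 0 < k%:R :> R by rewrite ltr0n.
set rk := Num.sqrt k%:R in max sc *.
have rk0 : 0 < rk by rewrite sqrtr_gt0.
have rk2 : rk ^+ 2 = k%:R by rewrite sqr_sqrtr// ltW.
set dl := norm2 (b - beta0) in far.
have dl0 : 0 < dl := lt_trans rho0 far.
pose u := dl^-1 *: (b - beta0).
have u1 : norm2 u = 1 by rewrite norm2Z gtr0_norm ?invr_gt0// mulVf// gt_eqF.
have bE x : dotp x b = dotp x beta0 + dl * dotp u x.
  have -> : dl * dotp u x = dotp x (b - beta0).
    by rewrite dotpZl mulrA divff ?gt_eqF// mul1r dotpC.
  by rewrite dotpBr addrC subrK.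
(* The directional score at the actual distance [dl] of [b]; the comparison with [rho] comes only
   after summation against the multiplier. *)
pose H (i : nat) := w (X i.+1%:Z om) * dotp u (X i.+1%:Z om) *
  ((e i.+1%:Z om <= dl * dotp u (X i.+1%:Z om))%R%:R - 2^-1).
have HE i : dotp (col_mx u 0) (gmom w phi y i.+1%:Z b om) = - H i.
  rewrite /gmom dotpZr dotp_col_mx0 /H.
  have -> : (y i.+1%:Z om - dotp (X i.+1%:Z om) b <= 0) =
      (e i.+1%:Z om <= dl * dotp u (X i.+1%:Z om)).
    by rewrite ARom bE -[RHS]subr_le0; congr (_ <= _); ring.
  ring.
have H_le i : `|H i| <= 2^-1 * norm2 (astarX i.+1%:Z om).
  have -> : `|H i| = `|dotp (col_mx u 0) (gmom w phi y i.+1%:Z b om)|.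
    by rewrite HE normrN.
  apply: le_trans (CauchySchwarz_dotp _ _) _.
  rewrite norm2_col_mx0 u1 mul1r norm2Z ler_wpM2r ?norm2_ge0//.
  case: (_ <= 0) => /=; rewrite ?subr0 ler_norml; lra.
have H_sq i : H i ^+ 2 <= 4^-1 * norm2 (astarX i.+1%:Z om) ^+ 2.
  have := H_le i; have := norm2_ge0 (astarX i.+1%:Z om).
  set N := norm2 _ => N0 HN.
  rewrite -[leLHS]real_normK ?num_real// (_ : 4^-1 * N ^+ 2 = (2^-1 * N) ^+ 2); last by field.
  by rewrite ler_pXn2r ?nnegrE ?normr_ge0 ?mulr_ge0 ?invr_ge0.
apply: el_sup_le; first exact: expR_ge0.
move=> v gv; apply: le_trans (el_product_le_first kn' gv) _.
have [v01 v1 _ vg _] := gv.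
have := @prod_scaled_weights_le_expR R _ [pred i : 'I_n | (i < k)%N] v
  (fun i => rk^-1 * H i).
rewrite (card_first_block kn') => /(_ _ v1) h.
apply: le_trans (h _ _ _) _ => {h}.
- by move=> i _; case/andP: (v01 i).
- have : dotp (col_mx u 0) (\sum_(i < n | (i < k)%N) v i *: gmom w phi y i.+1%:Z b om) = 0.
    by rewrite vg -(scale0r (0 : 'cV[R]_(p + q))) dotpZr mul0r.
  rewrite dotp_sumr => h.
  have -> : \sum_(i < n | (i < k)%N) v i * (rk^-1 * H i) =
     - rk^-1 * \sum_(i < n | (i < k)%N) dotp (col_mx u 0) (v i *: gmom w phi y i.+1%:Z b om).
    by rewrite mulr_sumr; apply: eq_bigr => i _; rewrite dotpZr HE; ring.
  by rewrite h mulr0.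
(* [|H i|] is at most half of [mu sqrt k] and [mu <= 1], so the scaled multiplier stays in the range
   allowed by weak duality. *)
- move=> i ik; have := max (Ordinal ik); rewrite /= add0n => hm.
  have : `|rk^-1 * H i| <= 2^-1.
    rewrite normrM gtr0_norm ?invr_gt0// mulrC ler_pdivrMr//.
    apply: le_trans (H_le i) _; rewrite ler_pM2l ?invr_gt0//.
    by apply: le_trans (ltW hm) _; rewrite ler_piMl// ltW.
  by rewrite ler_norml => /andP[].
rewrite ler_expR.
rewrite (sum_first_block (fun i => (rk^-1 * H i) ^+ 2) kn').
rewrite (sum_first_block (fun i => rk^-1 * H i) kn') -mulr_sumr.
have sq : \sum_(i < k) (rk^-1 * H (0 + i)%N) ^+ 2 <= K / 4.
  apply: le_trans (_ : (4 * k%:R)^-1 * \sum_(i < k) norm2 (astarX (tm 0 i) om) ^+ 2 <= _).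
    rewrite mulr_sumr; apply: ler_sum => i _; rewrite exprMn exprVn rk2 invfM [4^-1 * _]mulrC -mulrA.
    rewrite ler_pM2l ?invr_gt0//; exact: H_sq.
  rewrite mulrC ler_pdivrMr ?mulr_gt0//; apply: le_trans (ltW sumsq) _.
  by rewrite le_eqVlt; apply/orP; left; apply/eqP; field.
(* [H] is the drift at distance [dl] plus the score at the truth. The drift is at least its value at
   [rho], term by term, and the score costs at most [Z sqrt k] by Cauchy-Schwarz. *)
have HS : D - Z * rk <= \sum_(i < k) H (0 + i)%N.
  apply: le_trans (_ : \sum_(i < k) drift_term e y w rho u (tm 0 i) om +
     dotp (col_mx u 0) (\sum_(i < k) score (tm 0 i)) <= _).
    rewrite lerD ?drift//.
    have := CauchySchwarz_dotp (col_mx u (0 : 'cV[R]_q)) (\sum_(i < k) score (tm 0 i)).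
    rewrite norm2_col_mx0 u1 mul1r => /le_trans/(_ sc).
    by rewrite ler_norml => /andP[].
  rewrite dotp_sumr -big_split/=; apply: ler_sum => i _.
  set t := tm 0 i; rewrite /H -/t /drift_term /score dotpZr dotp_col_mx0.
  set x := dotp u _; set W := w _.
  have : 0 <= W * (x * ((e t om <= dl * x)%R%:R - (e t om <= rho * x)%R%:R)).
    rewrite pmulr_rge0 ?w_gt0//; have [x0|x0] := leP 0 x.
      rewrite mulr_ge0// subr_ge0 ler_nat; have [h|//] := leP (e t om) (rho * x).
      by rewrite lt0b (le_trans h)// ler_wpM2r// ltW.
    rewrite mulr_le0 ?(ltW x0)// subr_le0 ler_nat; have [h|//] := leP (e t om) (dl * x).
    by rewrite lt0b (le_trans h)// ler_wnM2r// ltW.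
  lra.
have : rk^-1 * (D - Z * rk) <= rk^-1 * \sum_(i < k) H (0 + i)%N.
  by rewrite ler_pM2l ?invr_gt0.
rewrite mulrBr [rk^-1 * (Z * rk)]mulrC mulfK ?gt_eqF// [rk^-1 * D]mulrC.
lra.
Qed.

Lemma mele_close (n k : nat) (B : set 'cV[R]_p) (b : 'cV[R]_p) (cG mu Z K D rho : R) :
  (0 < k < n)%N -> 0 < cG -> 0 <= mu <= 1 -> 0 <= Z -> 4 * Z * mu <= cG -> 0 < rho ->
  regular_block cG mu Z 0 k -> regular_block cG mu Z k (n - k) ->
  \sum_(i < k) norm2 (astarX (tm 0 i) om) ^+ 2 < K * k%:R ->
  (forall u, norm2 u = 1 -> D <= \sum_(i < k) drift_term e y w rho u (tm 0 i) om) ->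
  K / 2 + Z + 24 * Z ^+ 2 / cG < D / Num.sqrt k%:R ->
  B beta0 -> is_mele w phi y B n k om b -> norm2 (b - beta0) <= rho.
Proof.
move=> kn cG0 /andP[mu0 mu1] Z0 Zmu rho0 b1 b2 sumsq drift Dlarge Bbeta0 [_ bmax].
rewrite leNgt; apply/negP => far.
have truth := el_sup_truth kn cG0 mu0 Z0 Zmu b1 b2.
have farb := el_sup_far kn mu1 rho0 far b1 sumsq drift.
have := lt_le_trans (expR_gt0 _) truth => sup0.
have bbest : (- el_stat w phi y n k beta0 beta0 om <= - el_stat w phi y n k b b om)%E.
  by rewrite bmax; apply: ereal_sup_ubound; exists beta0.
have := neg_log_el_le sup0 bbest.
move=> /(le_trans truth)/le_trans/(_ farb); rewrite ler_expR; lra.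
Qed.

End Comparison.

(** * Choice of the constants and of the sample size *)

Theorem theorem3p1 (R : realType) (d : measure_display) (T : measurableType d)
  (P : probability T R) (p q : nat)
  (e y : int -> {RV P >-> R}) (f : R -> R)
  (w : 'cV[R]_p -> R) (phi : 'cV[R]_p -> 'cV[R]_q)
  (B : set 'cV[R]_p) (beta0 : 'cV[R]_p) (gamma r : R)
  (betahat : nat -> T -> 'cV[R]_p)
  (p_ge1 : (1 <= p)%N)
  (* i.i.d. innovations, and the model under the null hypothesis *)
  (e_indep : mutually_independent e)
  (e_ident : identically_distributed e)
  (H0 : stationary_causal_AR beta0 e y)
  (* weight and instrument functions *)
  (w_gt0 : forall x, 0 < w x)
  (w_meas : measurable_fun [set: borel_cV R p] (w : borel_cV R p -> R))
  (phi_meas : measurable_fun [set: borel_cV R p]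
                (phi : borel_cV R p -> borel_cV R q))
  (* (A1) *)
  (B_compact : compact B) (B_int : interior B !=set0)
  (beta0_int : interior B beta0)
  (B_stable : forall beta, B beta -> stable_poly beta)
  (e_median : forall t, is_median (e t) 0)
  (e_density : forall t, has_density (e t) f)
  (F_cont : forall t, {for 0, continuous (dist_fun (e t))})
  (F_deriv : forall t, is_derive (0 : R) (1 : R) (dist_fun (e t)) (f 0))
  (f0_gt0 : 0 < f 0)
  (* (A2) *)
  (moment_w : forall t : int,
     ('E_P[(fun om => let X := lags p y (t - 1) om in
              (w X + w X ^+ 2) *
              (norm2 (avec phi X) ^+ 2 + norm2 (avec phi X) ^+ 3))%R] < +oo)%E)
  (* (A3) *)
  (g_posdef : forall t : int,
     posdef (second_moment P (gmom w phi y t beta0)))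
  (* (A4) *)
  (gamma_gt2 : 2 < gamma)
  (moment_gamma : forall t : int,
     ('E_P[(fun om => norm2 (astar w phi (lags p y (t - 1) om)) `^ gamma)%R]
        < +oo)%E)
  (v_mixing : strong_mixing P (fun (t : int) (om : T) =>
     Num.sg (e t om) *: astar w phi (lags p y (t - 1) om)))
  (v_mixing_rate :
     (\sum_(1 <= l <oo)
        (alpha_mixing P (fun (t : int) (om : T) =>
           Num.sg (e t om) *: astar w phi (lags p y (t - 1) om)) l
         `^ (1 - 2 / gamma))%R%:E < +oo)%E)
  (* the estimator at k = floor (r n) *)
  (r_gt0 : 0 < r) (r_lt1 : r < 1)
  (betahat_meas : forall n, measurable_fun [set: T]
     (betahat n : T -> borel_cV R p))
  (betahat_mele : forall (n : nat) (om : T),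
     (1 <= Num.truncn (r * n%:R) <= n.-1)%N ->
     is_mele w phi y B n (Num.truncn (r * n%:R)) om (betahat n om)) :
  bigOp P (fun n om => betahat n om - beta0) (fun n => n%:R `^ (- (1 / 2))).
Proof.
have [AR ystat ycausal] := H0.
pose v (t : int) (om : T) := Num.sg (e t om) *: astar w phi (lags p y (t - 1) om).
have mv t : measurable_fun [set: T] (v t : T -> borel_cV R (p + q)).
  exact: measurable_signed_astarX.
have cpow : 0 < 1 - 2 / gamma <= 1.
  have g0 : 0 < gamma by rewrite (lt_trans _ gamma_gt2).
  rewrite subr_gt0 ltr_pdivrMr// mul1r gamma_gt2/= gerBl; apply: divr_ge0 => //.
  exact: ltW.
have [C alpha_sum] := summable_alpha_mixing mv cpow v_mixing_rate.
have [tau [eta [tau0 eta0 dotp_prob]]] :=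
  prob_dotp_ge w_meas phi_meas ystat gamma_gt2 moment_gamma g_posdef.
have good := whp_good_frequency ystat w_gt0 w_meas phi_meas e_density tau0 eta0
  dotp_prob alpha_sum.
have gram := whp_gram ystat w_gt0 w_meas phi_meas e_density tau0 eta0
  dotp_prob alpha_sum.
have Bbeta0 : B beta0 by exact: interior_subset beta0_int.
move=> eps eps0.
(* Eight events share [eps]: drift and sum of squares on the first block, and Gram bound, maximum
   and score on each of the two blocks. The autoregressive equation fails on a null set. *)
pose e8 := eps / 8; have e80 : 0 < e8 by exact: divr_gt0.
have [c [rho0 [A [k1 [c0 rho00 drift]]]]] :=
  whp_drift e_indep e_ident ycausal w_gt0 w_meas phi_meas (F_deriv 0) f0_gt0
    tau0 eta0 good e80.
have [Z Z0 score] := whp_score_norm e_indep e_ident ystat ycausal w_meas phi_meas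
  gamma_gt2 moment_gamma (e_median 0) e_density e80.
have [k2 {}gram] := gram _ e80.
pose cG := tau ^+ 2 * eta / 8.
have cG0 : 0 < cG by apply: divr_gt0 => //; apply: mulr_gt0 => //; exact: exprn_gt0.
(* The bound 1 is for the multiplier at distant parameters, the other one for positive weights at
   the truth. *)
pose mu := Num.min 1 (cG / (4 * Z)).
have mu0 : 0 < mu by rewrite lt_min ltr01 divr_gt0// mulr_gt0.
have mu1 : mu <= 1 by rewrite ge_min lexx.
have Zmu : 4 * Z * mu <= cG.
  by rewrite mulrC -ler_pdivlMr ?mulr_gt0// ge_min lexx orbT.
have [k3 maxn_] := whp_max ystat w_meas phi_meas gamma_gt2 moment_gamma e80 mu0.
pose K2 := Ex P (fun om => norm2 (astar w phi (lags p y (0 - 1) om)) ^+ 2).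
have K20 : 0 <= K2 by apply: Ex_ge0 => om; exact: sqr_ge0.
pose K := K2 / e8 + 1.
have K0 : 0 < K by rewrite ltr_wpDl// divr_ge0// ltW.
have K2K : K2 / K <= e8.
  by rewrite ler_pdivrMr// mulrC -ler_pdivrMr// lerDl.
pose Q := K / 2 + Z + 24 * Z ^+ 2 / cG + 1.
have Q0 : 0 < Q.
  by rewrite !addr_gt0 ?divr_gt0 ?mulr_gt0// exprn_gt0.
pose sr := Num.sqrt (r / 2).
have sr0 : 0 < sr by rewrite sqrtr_gt0 divr_gt0.
(* For large [n], [sqrt k >= sr * sqrt n], so [D / sqrt k = c sqrt k rho >= c sr M = Q]; the 1 added
   in [Q] makes the comparison of exponents strict. *)
pose M := Q / (c * sr).
have M0 : 0 < M by rewrite divr_gt0// mulr_gt0.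
exists M => //.
have r1 : 0 < 1 - r by rewrite subr_gt0.
(* In turn these ensure [rho <= rho0], [A <= k rho], that [k] passes the thresholds of its block,
   and that [n - k] does. *)
pose X1 := (M / rho0) ^+ 2. pose X2 := (2 * A / (r * M)) ^+ 2.
pose X3 : R := 2 * (k1 + k2 + k3 + 1)%N%:R / r. pose X4 : R := (k2 + k3 + 1)%N%:R / (1 - r).
have X10 : 0 <= X1 by exact: sqr_ge0.
have X20 : 0 <= X2 by exact: sqr_ge0.
have X30 : 0 <= X3 by apply: divr_ge0; [exact: mulr_ge0|exact: ltW].
have X40 : 0 <= X4 by apply: divr_ge0 => //; exact: ltW.
have [N NP] := exists_nat_ge (X1 + X2 + X3 + X4).
exists N => // n /= /NP[n_gt0 nX].
have nR : 0 < n%:R :> R by rewrite ltr0n.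
pose k := Num.truncn (r * n%:R).
have X1n : X1 <= n%:R by lra.
have X2n : X2 <= n%:R by lra.
have X3n : X3 <= n%:R by lra.
have X4n : X4 <= n%:R by lra.
pose s : R := Num.sqrt n%:R; have s0 : 0 < s by rewrite sqrtr_gt0.
have s2 : s ^+ 2 = n%:R by rewrite sqr_sqrtr// ltW.
have ge_s x : x ^+ 2 <= n%:R -> x <= s.
  move=> xn; apply: le_trans (ler_norm x) _.
  by rewrite -sqrtr_sqr ler_wsqrtr.
pose rho := M / s.
have rho_gt0 : 0 < rho by exact: divr_gt0.
have rhoE : M * n%:R `^ (- (1 / 2)) = rho.
  by rewrite powRN div1r powR12_sqrt// ltW.
have rn0 : 0 <= r * n%:R by apply: mulr_ge0 => //; exact: ltW.
have /andP[kle klt] := truncn_itv rn0; rewrite -/k in kle klt.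
have rn3 : (k1 + k2 + k3 + 1)%N%:R <= r * n%:R / 2.
  have := X3n; rewrite -(ler_pM2l r_gt0).
  by rewrite (_ : r * X3 = 2 * (k1 + k2 + k3 + 1)%N%:R); [lra|rewrite /X3; field; rewrite gt_eqF].
(* The floor loses at most 1, and [r n / 2 >= 1] thanks to the 1 added in [X3]. *)
have khalf : r * n%:R / 2 <= k%:R.
  by move: rn3 klt; rewrite !natrD -(natr1 k); have := ler0n R k1; have := ler0n R k2;
    have := ler0n R k3; lra.
have kbig : (k1 + k2 + k3 + 1 <= k)%N by rewrite -(ler_nat R) (le_trans rn3).
have kltn : (k < n)%N.
  rewrite -(ltr_nat R); apply: le_lt_trans kle _.
  by rewrite gtr_pMl.
have nkbig : (k2 + k3 + 1 <= n - k)%N.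
  rewrite -(ler_nat R) natrB; last exact: ltnW.
  apply: (@le_trans _ _ ((1 - r) * n%:R)); last by move: kle; lra.
  by rewrite mulrC -ler_pdivrMr.
have k_gt0 : (0 < k)%N by apply: leq_trans kbig; rewrite addn1.
have nk_gt0 : (0 < n - k)%N by apply: leq_trans nkbig; rewrite addn1.
have kR : 0 < k%:R :> R by rewrite ltr0n.
have rho_le : rho <= rho0.
  by rewrite /rho ler_pdivrMr// mulrC -ler_pdivrMr//; exact: ge_s.
have Ak : A <= k%:R * rho.
  have h : 2 * A / (r * M) <= s by exact: ge_s.
  have rM0 : 0 < r * M by exact: mulr_gt0.
  rewrite ler_pdivrMr// in h.
  apply: (@le_trans _ _ (r * n%:R / 2 * rho)); last by rewrite ler_wpM2r// ltW.
  have -> : r * n%:R / 2 * rho = s * (r * M) / 2.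
    by rewrite /rho -s2; field; rewrite gt_eqF.
  by rewrite ler_pdivlMr// mulrC.
pose D := c * (k%:R * rho).
have Dlarge : K / 2 + Z + 24 * Z ^+ 2 / cG < D / Num.sqrt k%:R.
  apply: (@lt_le_trans _ _ Q); first by rewrite /Q ltrDl.
  set rk := Num.sqrt k%:R; have rk0 : 0 < rk by rewrite sqrtr_gt0.
  have rk2 : rk ^+ 2 = k%:R by rewrite sqr_sqrtr// ltW.
  have -> : D / rk = c * rk * rho.
    by rewrite /D -rk2; field; rewrite gt_eqF.
  have srs : sr * s <= rk.
    rewrite /sr /s -sqrtrM; last by apply: divr_ge0 => //; exact: ltW.
    by apply: ler_wsqrtr; apply: le_trans khalf; rewrite mulrAC.
  have -> : Q = c * (sr * s) * rho.
    by rewrite /rho /M; field; rewrite !gt_eqF.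
  by rewrite ler_pM2r// ler_pM2l.
have arAE : {ae P, forall om, forall i : nat,
    y i.+1%:Z om = dotp (lags p y (i.+1%:Z - 1) om) beta0 + e i.+1%:Z om}.
  by apply: ae_foralln => i; exact: AR.
have le1 : (k1 <= k)%N by apply: leq_trans kbig; rewrite -!addnA leq_addr.
have le2 : (k2 <= k)%N by apply: leq_trans kbig; rewrite -!addnA addnCA leq_addr.
have le3 : (k3 <= k)%N.
  by apply: leq_trans kbig; rewrite addnAC leq_addl.
have le2' : (k2 <= n - k)%N by apply: leq_trans nkbig; rewrite -addnA leq_addr.
have le3' : (k3 <= n - k)%N by apply: leq_trans nkbig; rewrite addnAC leq_addl.
have rho_int : 0 < rho <= rho0 by rewrite rho_gt0.
have ev := whp_and (whp_ae arAE) (whp_and (drift k le1 rho rho_int Ak 0%N)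
  (whp_and (whp_le K2K (whp_sum_norm_sqr ystat w_meas phi_meas gamma_gt2 moment_gamma 0 K0 k_gt0))
  (whp_and (whp_and (gram k le2 0%N) (whp_and (maxn_ k le3 0%N) (score k 0%N k_gt0)))
    (whp_and (gram (n - k)%N le2' k) (whp_and (maxn_ (n - k)%N le3' k) (score (n - k)%N k nk_gt0)))))).
apply: (prob_le_whp _ (whp_le _ ev)).
- have mZ : measurable_fun [set: T] (fun om => norm2 (betahat n om - beta0)).
    apply: (measurableT_comp (@measurable_norm2 R p)).
    apply: measurable_borel_cV => i.
    rewrite (_ : (fun om => _) = fun om => betahat n om i 0 - beta0 i 0); last first.
      by apply/funext => om; rewrite !mxE.
    by apply: measurable_funB => //; exact: measurable_cV_coord.
  have := mZ measurableT _ (measurable_itv `]M * n%:R `^ (- (1 / 2)), +oo[).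
  by rewrite setTI; congr measurable; apply/seteqP; split => om /=; rewrite in_itv/= andbT.
- by rewrite /e8; lra.
move=> om [ARom [dr [ss [[g1 [m1 s1]] [g2 [m2 s2']]]]]].
apply/negP; rewrite -leNgt rhoE.
have kn : (0 < k < n)%N by rewrite k_gt0.
have mu01 : 0 <= mu <= 1 by rewrite ltW.
have b1 : regular_block e y w phi om cG mu Z 0 k by split.
have b2 : regular_block e y w phi om cG mu Z k (n - k) by split.
apply: (mele_close w_gt0 ARom kn cG0 mu01 (ltW Z0) Zmu rho_gt0 b1 b2 ss dr Dlarge Bbeta0).
by apply: betahat_mele; rewrite k_gt0/= -ltnS prednK.
Qed.
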